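(* On the hybrid fractal $\mathrm H$, the resistance forms $(\mathcal E,\operatorname{dom}\mathcal E)$ and $(\widetilde{\mathcal E},\operatorname{dom}\widetilde{\mathcal E})$ defined in the context coincide.
   Context: **The hybrid $\mathrm H$.** Let $q_1,q_2,q_3\in\mathbb R^2$ be the vertices of a unit equilateral triangle, $V_0=\{q_1,q_2,q_3\}$, and $q_{ij}=(q_i+q_j)/2$. Fix $0<s<1/3$. Consider the six similitudes $\phi_{q}(x)=sx+(1-s)q$ with $q\in\{q_1,q_2,q_3,q_{12},q_{13},q_{23}\}$, enumerated as $\phi_1,\dots,\phi_6$. Let $J$ be the collection consisting of the six line segments joining $\phi_{q_i}(q_j)$ with $\phi_{q_{ij}}(q_i)$ (one for each ordered pair $i\ne j$ in $\{1,2,3\}$), and of one (inverted) Sierpinski gasket, denoted $\mathrm{SG}$, with outer vertices $\phi_{q_{12}}(q_3),\phi_{q_{23}}(q_1),\phi_{q_{13}}(q_2)$. The hybrid $\mathrm H\subseteq\mathbb R^2$ is the unique non-empty compact set with $\mathrm H=\bigcup_{i=1}^6\phi_i(\mathrm H)\cup\bigcup_{K\in J}K$. For $n\ge1$, $\mathcal A_n=\{1,\dots,6\}^n$, $\mathcal A_0=\{\emptyset\}$, $\phi_\alpha=\phi_{\alpha_1}\circ\cdots\circ\phi_{\alpha_n}$, $\phi_\emptyset=\mathrm{id}$. An $n$-cell is a set $\phi_\alpha(\mathrm H)$, $\alpha\in\mathcal A_n$. **The form $\mathcal E$.** Fix $0<r<7/15$ and $R=30/(9-31r+\sqrt{81+r(61r-138)})$.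 For $n\ge0$ the weighted graph $\Gamma_n=(V_n,E_n,r_n)$ has the edges: (a) for each $\alpha\in\mathcal A_n$ the three edges of the triangle with vertices $\phi_\alpha(V_0)$, resistance $Rr^n$; (b) for $1\le k\le n$, $\alpha\in\mathcal A_{k-1}$ and each segment $\mathrm I\in J$, the $2^{n-k}$ equal subsegments of $\phi_\alpha(\mathrm I)$, resistance $r^{k-1}(1/2)^{n-k}$; (c) for $1\le k\le n$, $\alpha\in\mathcal A_{k-1}$, the edges of the level-$(n-k)$ graph approximation of the gasket $\phi_\alpha(\mathrm{SG})$ (level $0$ is the outer triangle), resistance $r^{k-1}(3/5)^{n-k}$. $V_n$ is the set of endpoints. Put $\mathcal E_n(u,v)=\sum_{\{x,y\}\in E_n}r_n(x,y)^{-1}(u(x)-u(y))(v(x)-v(y))$. This sequence is compatible (each $\mathcal E_n$ is the trace of $\mathcal E_{n+1}$ on $V_n$), and $(\mathcal E,\operatorname{dom}\mathcal E)$ is the resulting resistance form extended to $\mathrm H$ by continuity: $\mathcal E(u,v)=\lim_n\mathcal E_n(u|_{V_n},v|_{V_n})$ for $u,v$ in $\operatorname{dom}\mathcal E=\{u\colon\mathrm H\to\mathbb R \text{ continuous with finite limit } \mathcal E(u,u)\}$. **The form $\widetilde{\mathcal E}$.** $\widetilde{\mathcal F}_n=\{u\in\operatorname{dom}\mathcal E: u\text{ is constant on every }n\text{-cell}\}$. $\mathcal E^{\mathrm I}$ is the standard energy on the segment $\mathrm I$: $\mathcal E^{\mathrm I}(u,u)=\int_0^1|(u\circ\gamma)'(t)|^2dt$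 with $\gamma\colon[0,1]\to\mathrm I$ an affine bijection. $\mathcal E^{\mathrm{SG}}$ is the standard energy on the gasket: $\mathcal E^{\mathrm{SG}}(u,u)=\lim_n(5/3)^n\sum(u(x)-u(y))^2$, sum over edges $\{x,y\}$ of the level-$n$ graph approximation. For $k\ge0$, $\alpha\in\mathcal A_k$: $\mathcal E_k^{\mathrm I_\alpha}(u,v)=r^{-k}\mathcal E^{\mathrm I}((u\circ\phi_\alpha)|_{\mathrm I},(v\circ\phi_\alpha)|_{\mathrm I})$ and $\mathcal E_k^{\mathrm{SG}_\alpha}(u,v)=r^{-k}\mathcal E^{\mathrm{SG}}((u\circ\phi_\alpha)|_{\mathrm{SG}},(v\circ\phi_\alpha)|_{\mathrm{SG}})$. Then $$\widetilde{\mathcal E}(u,v)=\sum_{k=0}^\infty\sum_{\alpha\in\mathcal A_k}\Big(\sum_{\mathrm I\in J}\mathcal E_k^{\mathrm I_\alpha}(u,v)+\mathcal E_k^{\mathrm{SG}_\alpha}(u,v)\Big)$$ (inner sum over the segments $\mathrm I\in J$), with domain $\operatorname{dom}\widetilde{\mathcal E}$ the set of $u\in\operatorname{dom}\mathcal E$ for which there is a sequence $\{u_n\}\subseteq\bigcup_{n\ge1}\widetilde{\mathcal F}_n$ with $\mathcal E(u-u_n,u-u_n)\to0$ and $u_n(x)\to u(x)$ for all $x\in\mathrm H$. ''Coincide'' means equal domains and equal values of the bilinear forms. *)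

(* Defs.v *)
From HB Require Import structures.
From mathcomp Require Export all_boot all_order all_algebra.
From mathcomp Require Export all_classical all_reals all_analysis.
Export numFieldNormedType.Exports.

Set Implicit Arguments.
Unset Strict Implicit.
Unset Printing Implicit Defensive.

Import Order.TTheory GRing.Theory Num.Theory.

Open Scope classical_set_scope.
Open Scope ring_scope.

(* * Geometry *)

(* The plane; its topology is that of the sup norm, so compactness and
   continuity have their Euclidean meaning. *)
Notation plane R := 'rV[R]_2.

Definition eucl_dist (R : realType) (x y : plane R) : R :=
  Num.sqrt (\sum_(i < 2) (x 0 i - y 0 i) ^+ 2).

Definition unit_equilateral (R : realType) (q : 'I_3 -> plane R) : Prop :=
  forall i j : 'I_3, i != j -> eucl_dist (q i) (q j) = 1.

Definition midpoint (R : realType) (x y : plane R) : plane R :=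
  2^-1 *: (x + y).

Definition simil (R : realType) (c : R) (a x : plane R) : plane R :=
  c *: x + (1 - c) *: a.

Definition word_map (T I : Type) (f : I -> T -> T) (w : seq I) : T -> T :=
  foldr (fun i g => f i \o g) id w.

(* The line segment from [a] to [b] is the image of [0, 1] by [gamma a b]. *)
Definition gamma (R : realType) (a b : plane R) (t : R) : plane R :=
  (1 - t) *: a + t *: b.

Definition segment (R : realType) (a b : plane R) : set (plane R) :=
  gamma a b @` `[0, 1].

Definition is_gasket (R : realType) (p : 'I_3 -> plane R)
    (SG : set (plane R)) : Prop :=
  [/\ SG !=set0, compact SG &
      SG = \bigcup_(i in [set: 'I_3]) (simil 2^-1 (p i) @` SG)].

(* In ['I_3], the vertices q_1, q_2, q_3 have the indices 0, 1, 2. *)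
Definition center (R : realType) (q : 'I_3 -> plane R) (i : 'I_6) : plane R :=
  tnth [tuple q 0; q 1; q 2; midpoint (q 0) (q 1); midpoint (q 0) (q 2);
              midpoint (q 1) (q 2)] i.

Definition phi (R : realType) (q : 'I_3 -> plane R) (s : R) (i : 'I_6) :
    plane R -> plane R :=
  simil s (center q i).

Definition phiw (R : realType) (q : 'I_3 -> plane R) (s : R) (n : nat)
    (alpha : n.-tuple 'I_6) : plane R -> plane R :=
  word_map (phi q s) alpha.

(* End points of the segment of J attached to the ordered pair i != j. *)
Definition seg_a (R : realType) (q : 'I_3 -> plane R) (s : R)
    (ij : 'I_3 * 'I_3) : plane R :=
  simil s (q ij.1) (q ij.2).

Definition seg_b (R : realType) (q : 'I_3 -> plane R) (s : R)
    (ij : 'I_3 * 'I_3) : plane R :=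
  simil s (midpoint (q ij.1) (q ij.2)) (q ij.1).

(* Outer vertices of the gasket of J. *)
Definition sg_vertex (R : realType) (q : 'I_3 -> plane R) (s : R) (i : 'I_3) :
    plane R :=
  tnth [tuple simil s (midpoint (q 0) (q 1)) (q 2);
              simil s (midpoint (q 1) (q 2)) (q 0);
              simil s (midpoint (q 0) (q 2)) (q 1)] i.

Definition is_hybrid (R : realType) (q : 'I_3 -> plane R) (s : R)
    (SG H : set (plane R)) : Prop :=
  [/\ H !=set0, compact H &
      H = \bigcup_(i in [set: 'I_6]) (phi q s i @` H)
          `|` (\bigcup_(ij in [set ij : 'I_3 * 'I_3 | ij.1 != ij.2])
                 segment (seg_a q s ij) (seg_b q s ij)
               `|` SG)].

(* * Weighted graphs *)

(* A weighted edge [(x, y, rho)] joins x and y with resistance rho. A graph is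
   given by a list in which each unordered edge occurs once. *)
Definition wedge (R : realType) : Type := (plane R * plane R * R)%type.

Definition graph_form (R : realType) (G : seq (wedge R))
    (u v : plane R -> R) : R :=
  \sum_(e <- G) e.2^-1 * (u e.1.1 - u e.1.2) * (v e.1.1 - v e.1.2).

Definition image_edge (R : realType) (f : plane R -> plane R) (rho : R)
    (e : plane R * plane R) : wedge R :=
  (f e.1, f e.2, rho).

Definition triangle_edges (R : realType) (p : 'I_3 -> plane R) :
    seq (plane R * plane R) :=
  [:: (p 0, p 1); (p 0, p 2); (p 1, p 2)].

(* The 2 ^ m equal subsegments of the segment from [a] to [b]. *)
Definition segment_edges (R : realType) (a b : plane R) (m : nat) :
    seq (plane R * plane R) :=
  [seq (gamma a b (l%:R / 2 ^+ m), gamma a b (l.+1%:R / 2 ^+ m))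
     | l <- iota 0 (2 ^ m)].

(* The level-m graph approximation of the gasket with outer vertices [p]. *)
Definition gasket_edges (R : realType) (p : 'I_3 -> plane R) (m : nat) :
    seq (plane R * plane R) :=
  flatten [seq triangle_edges
                 (fun i => word_map (fun j => simil 2^-1 (p j)) w (p i))
             | w : m.-tuple 'I_3].

Definition Rconst (R : realType) (r : R) : R :=
  30 / (9 - 31 * r + Num.sqrt (81 + r * (61 * r - 138))).

Definition cell_wedges (R : realType) (q : 'I_3 -> plane R) (s r : R)
    (n : nat) : seq (wedge R) :=
  [seq image_edge (phiw q s alpha) (Rconst r * r ^+ n) e
     | alpha <- enum {: n.-tuple 'I_6}, e <- triangle_edges q].

Definition segment_wedges (R : realType) (q : 'I_3 -> plane R) (s r : R)
    (n k : nat) (ij : 'I_3 * 'I_3) : seq (wedge R) :=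
  [seq image_edge (phiw q s alpha) (r ^+ k.-1 * 2^-1 ^+ (n - k)) e
     | alpha <- enum {: k.-1.-tuple 'I_6},
       e <- segment_edges (seg_a q s ij) (seg_b q s ij) (n - k)].

Definition gasket_wedges (R : realType) (q : 'I_3 -> plane R) (s r : R)
    (n k : nat) : seq (wedge R) :=
  [seq image_edge (phiw q s alpha) (r ^+ k.-1 * (3 / 5) ^+ (n - k)) e
     | alpha <- enum {: k.-1.-tuple 'I_6},
       e <- gasket_edges (sg_vertex q s) (n - k)].

Definition Gamma (R : realType) (q : 'I_3 -> plane R) (s r : R) (n : nat) :
    seq (wedge R) :=
  cell_wedges q s r n
  ++ flatten [seq segment_wedges q s r n k ij
                | k <- iota 1 n,
                  ij <- enum [pred ij : 'I_3 * 'I_3 | ij.1 != ij.2]]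
  ++ flatten [seq gasket_wedges q s r n k | k <- iota 1 n].

(* * Forms *)

(* A function on H is represented by any extension of it to the plane; every
   notion below depends only on the values on H. *)
Record form (R : realType) : Type := Form {
  dom : set (plane R -> R) ;
  value : (plane R -> R) -> (plane R -> R) -> R }.

Definition coincide (R : realType) (F G : form R) : Prop :=
  dom F = dom G /\
  (forall u v, dom F u -> dom F v -> value F u v = value G u v).

(* ** The form E *)

Definition En (R : realType) (q : 'I_3 -> plane R) (s r : R) (n : nat)
    (u v : plane R -> R) : R :=
  graph_form (Gamma q s r n) u v.

Definition E (R : realType) (q : 'I_3 -> plane R) (s r : R)
    (u v : plane R -> R) : R :=
  limn (fun n => En q s r n u v).

Definition domE (R : realType) (q : 'I_3 -> plane R) (s r : R)
    (H : set (plane R)) : set (plane R -> R) :=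
  [set u | {within H, continuous u} /\ cvgn (fun n => En q s r n u u)].

Definition formE (R : realType) (q : 'I_3 -> plane R) (s r : R)
    (H : set (plane R)) : form R :=
  Form (domE q s r H) (E q s r).

(* ** The form E~ *)

(* [derive1 f] is the pointwise derivative (0 where f is not derivable). If u is in
   dom E, the restriction of u to a segment is in the Sobolev space H^1, hence
   absolutely continuous: the derivative exists almost everywhere and is the
   weak one. *)
Definition energy_segment (R : realType) (a b : plane R)
    (u v : plane R -> R) : R :=
  \int[@lebesgue_measure R]_(t in `[0, 1])
    (derive1 (u \o gamma a b) t * derive1 (v \o gamma a b) t).

Definition energy_gasket (R : realType) (p : 'I_3 -> plane R)
    (u v : plane R -> R) : R :=
  limn (fun m => (5 / 3) ^+ m *
    \sum_(e <- gasket_edges p m) (u e.1 - u e.2) * (v e.1 - v e.2)).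

Definition energy_segment_at (R : realType) (q : 'I_3 -> plane R) (s r : R)
    (k : nat) (alpha : k.-tuple 'I_6) (ij : 'I_3 * 'I_3)
    (u v : plane R -> R) : R :=
  r ^- k * energy_segment (seg_a q s ij) (seg_b q s ij)
                          (u \o phiw q s alpha) (v \o phiw q s alpha).

Definition energy_gasket_at (R : realType) (q : 'I_3 -> plane R) (s r : R)
    (k : nat) (alpha : k.-tuple 'I_6) (u v : plane R -> R) : R :=
  r ^- k * energy_gasket (sg_vertex q s)
                         (u \o phiw q s alpha) (v \o phiw q s alpha).

Definition Etilde (R : realType) (q : 'I_3 -> plane R) (s r : R)
    (u v : plane R -> R) : R :=
  limn (series (fun k => \sum_(alpha : k.-tuple 'I_6)
    (\sum_(ij : 'I_3 * 'I_3 | ij.1 != ij.2)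
        energy_segment_at q s r alpha ij u v
     + energy_gasket_at q s r alpha u v))).

Definition Ftilde (R : realType) (q : 'I_3 -> plane R) (s r : R)
    (H : set (plane R)) (n : nat) : set (plane R -> R) :=
  [set u | domE q s r H u /\
     forall alpha : n.-tuple 'I_6,
     forall x y, (phiw q s alpha @` H) x -> (phiw q s alpha @` H) y ->
       u x = u y].

Definition domEtilde (R : realType) (q : 'I_3 -> plane R) (s r : R)
    (H : set (plane R)) : set (plane R -> R) :=
  [set u | domE q s r H u /\
     exists w : nat -> plane R -> R,
       [/\ forall m, exists2 n, (1 <= n)%N & Ftilde q s r H n (w m),
           (fun m => E q s r (u \- w m) (u \- w m)) @ \oo --> (0 : R) &
           forall x, H x -> (fun m => w m x) @ \oo --> u x]].

Definition formEtilde (R : realType) (q : 'I_3 -> plane R) (s r : R)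
    (H : set (plane R)) : form R :=
  Form (domEtilde q s r H) (Etilde q s r).

(* Main.v *)
Require Import Defs.
From mathcomp Require Import ring lra measurable_realfun zify.

Set Implicit Arguments.
Unset Strict Implicit.
Unset Printing Implicit Defensive.
Import Order.TTheory GRing.Theory Num.Theory.
Local Open Scope classical_set_scope.
Local Open Scope ring_scope.

(** Each E_n is the sum of the energy C_n of the triangles phi_alpha(V_0) with
    alpha of length n, and of the energy L_n of the segments and gaskets that
    link the cells. The discrete energy of a segment or of a gasket increases
    with its level, so L_n increases, and its limit is the series that defines
    E~. Hence the two forms take the same values on dom E as soon as C_n(u)
    tends to 0 for every u in dom E.

    This is a property of the network. Write T for the energy of the triangle
    on V_0. The constant R is the solution of a quadratic equation which says
    that the triangle of resistance R is equivalent to the first approximation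
    of the hybrid. An explicit current flow and Thomson's principle therefore
    give T(u) <= C_1(u) + L_1(u). The flow dissipates a fixed proportion of its
    energy in the links, so that doubling the conductance of the links improves
    the bound to (1 + eta) T(u) <= C_1(u) + 2 L_1(u) with eta > 0
    ([network_bound], [triangle_form_trace]). Applied in all n-cells, this reads
    (1 + eta) C_n <= C_(n+1) + 2 (L_(n+1) - L_n). For u in dom E both C_n and
    L_n converge, and in the limit (1 + eta) lim C_n <= lim C_n, whence
    lim C_n = 0 ([cell_energy_vanishes]).

    The same fact gives the approximation by functions that are constant on
    cells. Keep u outside the n-cells and replace it in each n-cell by a
    function with the same values at the three corners, constant on every
    subcell and on the gasket, and affine on the segments ([crude], [glue],
    [approx]). The energy of the new function inside the n-cells is at most a
    constant times C_n(u); the energy of u there is at most E(u,u) - L_n(u).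
    Both tend to 0, so the difference tends to 0 in energy ([approx_energy]);
    it tends to 0 pointwise because the cells shrink ([approx_cvg]).

    Finally, E~ measures a segment by the integral of the product of pointwise
    derivatives, and the limit of the dyadic energies has to be identified with
    this integral ([cvg_dyadic_form]). The dyadic difference quotients of a
    function with bounded dyadic energies form a martingale bounded in L2. A
    rapidly converging subsequence has a limit g almost everywhere, the function
    is a primitive of g, and Lebesgue's differentiation theorem shows that g is
    its derivative almost everywhere. *)

(** * Dyadic step functions *)

Section dyadic_steps.
Variable R : realType.
Notation mu := (@lebesgue_measure R).

Definition dyadic (n l : nat) : R := l%:R / 2 ^+ n.

Definition dyadic_itv (n l : nat) : set R := `[dyadic n l, dyadic n l.+1[.

Definition dyadic_step (n : nat) (c : nat -> R) (x : R) : R :=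
  \sum_(0 <= l < 2 ^ n) c l * \1_(dyadic_itv n l) x.

Lemma pow2_gt0 n : 0 < 2 ^+ n :> R.
Proof. by rewrite exprn_gt0. Qed.
Hint Resolve pow2_gt0 : core.

Lemma dyadic_itvP n l x :
  dyadic_itv n l x <-> 0 <= x /\ l = Num.truncn (2 ^+ n * x).
Proof.
rewrite /dyadic_itv /= in_itv /= /dyadic ler_pdivrMr// ltr_pdivlMr//.
rewrite (mulrC x); split => [/andP[h1 h2]|[x0 ->]].
  split; last by rewrite (@truncn_def _ _ l)// h1.
  have : 0 <= 2 ^+ n * x by apply: le_trans h1.
  by rewrite pmulr_rge0.
by rewrite truncn_itv// mulr_ge0// ltW.
Qed.

Lemma truncn_lt_pow2 n (x : R) : x < 1 -> (Num.truncn (2 ^+ n * x) < 2 ^ n)%N.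
Proof.
move=> x1; have n0 : (0 < 2 ^ n)%N by rewrite expn_gt0.
rewrite -(prednK n0) ltnS truncn_le_nat prednK// natrX.
by rewrite gtr_pMr.
Qed.

Lemma dyadic_step_in n c x : 0 <= x < 1 ->
  dyadic_step n c x = c (Num.truncn (2 ^+ n * x)).
Proof.
move=> /andP[x0 x1]; rewrite /dyadic_step.
rewrite (bigD1_seq (Num.truncn (2 ^+ n * x))) ?iota_uniq//=; last first.
  by rewrite mem_index_iota truncn_lt_pow2.
rewrite big1_seq ?addr0 => [|l /andP[ln _]].
  by rewrite indicE mem_set ?mulr1//; apply/dyadic_itvP.
rewrite indicE memNset ?mulr0// => /dyadic_itvP[_ lE].
by rewrite lE eqxx in ln.
Qed.

Lemma dyadic_step_out n c x : ~~ (0 <= x < 1) -> dyadic_step n c x = 0.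
Proof.
move=> x01; rewrite /dyadic_step big1_seq// => l /= /[!mem_index_iota] ln.
rewrite indicE memNset ?mulr0// /dyadic_itv /= in_itv /= => /andP[h1 h2].
move/negP : x01; apply; apply/andP; split.
  by apply: le_trans h1; rewrite /dyadic divr_ge0.
apply: lt_le_trans h2 _; rewrite /dyadic ler_pdivrMr// mul1r.
by rewrite -natrX ler_nat.
Qed.

(** Step functions vanish outside [0, 1[, which is why F must vanish at 0, 0. *)
Lemma dyadic_step_comp2 n (F : R -> R -> R) c d x : F 0 0 = 0 ->
  F (dyadic_step n c x) (dyadic_step n d x) =
  dyadic_step n (fun l => F (c l) (d l)) x.
Proof.
move=> F0; have [x01|x01] := boolP (0 <= x < 1).
  by rewrite !dyadic_step_in.
by rewrite !dyadic_step_out.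
Qed.

Lemma truncn_half n (x : R) : 0 <= x ->
  Num.truncn (2 ^+ n * x) = (Num.truncn (2 ^+ n.+1 * x) %/ 2)%N.
Proof.
move=> x0; have xn0 k : 0 <= 2 ^+ k * x by rewrite mulr_ge0// ltW.
apply/eqP; rewrite truncn_eq//.
set l := Num.truncn (2 ^+ n.+1 * x).
have /andP[h1 h2] : l%:R <= 2 ^+ n.+1 * x < l.+1%:R.
  exact: truncn_itv.
have h3 : ((l %/ 2 * 2)%:R <= l%:R :> R) by rewrite ler_nat leq_divM.
have h4 : (l.+1%:R <= ((l %/ 2).+1 * 2)%:R :> R).
  by rewrite ler_nat ltn_ceil.
move: h1 h2 h3 h4; rewrite exprS !natrM => h1 h2 h3 h4.
by apply/andP; split; [lra|lra].
Qed.

Lemma truncn_shift n k (x : R) : 0 <= x ->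
  Num.truncn (2 ^+ n * x) = (Num.truncn (2 ^+ (n + k) * x) %/ 2 ^ k)%N.
Proof.
move=> x0; elim: k => [|k IH]; first by rewrite addn0 divn1.
by rewrite IH addnS truncn_half// -divnMA expnS.
Qed.

Lemma dyadic_step_refine n k c x :
  dyadic_step n c x = dyadic_step (n + k) (fun l => c (l %/ 2 ^ k)%N) x.
Proof.
have [/[dup] x01 /andP[x0 x1]|x01] := boolP (0 <= x < 1).
  by rewrite !dyadic_step_in// -truncn_shift.
by rewrite !dyadic_step_out.
Qed.

Lemma dyadic_itv_measure n l : mu (dyadic_itv n l) = (2 ^- n)%:E.
Proof.
rewrite /dyadic_itv lebesgue_measure_itv /= lte_fin /dyadic.
rewrite ltr_pM2r ?invr_gt0// ltr_nat ltnSn -EFinD -mulrBl.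
by rewrite -natrB// subSnn mul1r.
Qed.

Lemma dyadic_step_measurable n c : measurable_fun setT (dyadic_step n c).
Proof.
apply: measurable_sum => l.
by apply: measurable_funM => //; exact: measurable_indic (measurable_itv _).
Qed.

Lemma dyadic_step_integrable n c :
  mu.-integrable setT (EFin \o dyadic_step n c).
Proof.
have -> : EFin \o dyadic_step n c =
    fun x => (\sum_(0 <= l < 2 ^ n) (c l * \1_(dyadic_itv n l) x)%:E)%E.
  by apply/funext => x /=; rewrite sumEFin.
apply: (@integrable_sum _ _ _ mu setT measurableT) => l _.
apply: (@integrableZl _ _ _ mu setT measurableT (c l)
  (EFin \o \1_(dyadic_itv n l))).
exact: integrable_indic_itv.
Qed.

Lemma dyadic_step_integral n c :
  (\int[mu]_x (dyadic_step n c x)%:E =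
   (\sum_(0 <= l < 2 ^ n) c l / 2 ^+ n)%:E)%E.
Proof.
under eq_integral => x _ do rewrite -sumEFin.
rewrite (@integral_sum _ _ _ mu setT measurableT); last first.
  move=> l; apply: (@integrableZl _ _ _ mu setT measurableT (c l)
    (EFin \o \1_(dyadic_itv n l))).
  exact: integrable_indic_itv.
rewrite -sumEFin; apply: eq_bigr => l _.
rewrite (@integralZl _ _ _ mu setT measurableT (EFin \o \1_(dyadic_itv n l)))//;
  last exact: integrable_indic_itv.
rewrite integral_indic//; last exact: measurable_itv.
rewrite setIT EFinM; congr (_ * _)%E; exact: dyadic_itv_measure.
Qed.

End dyadic_steps.

(** * Difference quotients and dyadic energies *)

Section dyadic_energy.
Variables (R : realType) (f : R -> R).
Notation mu := (@lebesgue_measure R).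

Definition slope (n l : nat) : R :=
  2 ^+ n * (f (dyadic R n l.+1) - f (dyadic R n l)).

Definition dyadic_energy (n : nat) : R :=
  \sum_(0 <= l < 2 ^ n) slope n l ^+ 2 / 2 ^+ n.

Lemma sum_pow2S (V : nmodType) n (F : nat -> V) :
  \sum_(0 <= l < 2 ^ n.+1) F l = \sum_(0 <= l < 2 ^ n) (F l.*2 + F l.*2.+1).
Proof.
rewrite expnSr big_nat_mul; apply: eq_bigr => l _.
by rewrite !muln2 doubleS big_nat_recl// big_nat1.
Qed.

Lemma dyadicS n l : dyadic R n.+1 l.*2 = dyadic R n l.
Proof.
rewrite /dyadic exprS -muln2 natrM.
have /negPf n0 : 2 ^+ n != 0 :> R by rewrite expf_neq0.
by field; rewrite ?n0.
Qed.

Lemma slopeS n l : slope n.+1 l.*2 + slope n.+1 l.*2.+1 = 2 * slope n l.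
Proof.
rewrite /slope -doubleS !dyadicS exprS; ring.
Qed.

(** The quotients of level m are the averages of those of level m + k over the
    intervals of level m: this is the martingale property, in the form that the
    increment from level m to level m + k is orthogonal to level m. *)
Lemma slope_cross m k :
  \sum_(0 <= l < 2 ^ (m + k)%N)
     slope (m + k)%N l * slope m (l %/ 2 ^ k)%N / 2 ^+ (m + k)%N =
  dyadic_energy m.
Proof.
elim: k => [|k IH].
  by rewrite addn0; apply: eq_bigr => l _; rewrite divn1 expr2.
rewrite -IH addnS sum_pow2S; apply: eq_bigr => l _.
have -> : (l.*2 %/ 2 ^ k.+1 = l %/ 2 ^ k)%N.
  by rewrite expnS divnMA -muln2 mulnK.
have -> : (l.*2.+1 %/ 2 ^ k.+1 = l %/ 2 ^ k)%N.
  by rewrite expnS divnMA divn2 /= uphalf_double.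
rewrite -mulrDl -mulrDl slopeS exprS.
have n0 : 2 ^+ (m + k)%N != 0 :> R by rewrite expf_neq0.
by field.
Qed.

(** Pythagoras for the martingale of difference quotients. *)
Lemma slope_dist m k :
  \sum_(0 <= l < 2 ^ (m + k)%N)
     (slope (m + k)%N l - slope m (l %/ 2 ^ k)%N) ^+ 2 / 2 ^+ (m + k)%N =
  dyadic_energy (m + k)%N - dyadic_energy m.
Proof.
have sq : \sum_(0 <= l < 2 ^ (m + k)%N)
     slope m (l %/ 2 ^ k)%N ^+ 2 / 2 ^+ (m + k)%N = dyadic_energy m.
  elim: k => [|k IH].
    by rewrite addn0; apply: eq_bigr => l _; rewrite divn1 expr2.
  rewrite -IH addnS sum_pow2S; apply: eq_bigr => l _.
  have -> : (l.*2 %/ 2 ^ k.+1 = l %/ 2 ^ k)%N.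
    by rewrite expnS divnMA -muln2 mulnK.
  have -> : (l.*2.+1 %/ 2 ^ k.+1 = l %/ 2 ^ k)%N.
    by rewrite expnS divnMA divn2 /= uphalf_double.
  rewrite [2 ^+ _.+1]exprS.
  have n0 : 2 ^+ (m + k)%N != 0 :> R by rewrite expf_neq0.
  by field.
transitivity (\sum_(0 <= l < 2 ^ (m + k)%N)
  (slope (m + k)%N l ^+ 2 / 2 ^+ (m + k)%N
   - slope (m + k)%N l * slope m (l %/ 2 ^ k)%N / 2 ^+ (m + k)%N *+ 2
   + slope m (l %/ 2 ^ k)%N ^+ 2 / 2 ^+ (m + k)%N)).
  by apply: eq_bigr => l _; ring.
rewrite big_split /= sumrB sumrMnl slope_cross sq /dyadic_energy; ring.
Qed.

Lemma dyadic_energy_nd : {homo dyadic_energy : m n / (m <= n)%N >-> m <= n}.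
Proof.
move=> m n /subnKC <-; rewrite -subr_ge0 -slope_dist.
by apply: sumr_ge0 => l _; rewrite divr_ge0 ?sqr_ge0 ?ltW.
Qed.

Definition slopes (n : nat) : R -> R := dyadic_step n (slope n).

(** The integral up to a dyadic point telescopes. Combined with a passage to the
    limit in n, this makes the function a primitive of the limit. *)
Lemma slopes_integral n j : (j <= 2 ^ n)%N ->
  (\int[mu]_(x in `[0%R, dyadic R n j]) (slopes n x)%:E =
   (f (dyadic R n j) - f 0)%:E)%E.
Proof.
move=> jn; rewrite -integral_itv_bndo_bndc; last first.
  by apply/measurable_EFinP; apply: measurable_funTS;
    exact: dyadic_step_measurable.
rewrite integral_mkcond.
pose c l := if (l < j)%N then slope n l else 0.
transitivity (\int[mu]_x (dyadic_step n c x)%:E)%E.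
  apply: eq_integral => x _; rewrite patchE.
  case: ifPn => [|/negP xj].
    rewrite inE /= in_itv /= => /andP[x0 xj].
    have tj : (Num.truncn (2 ^+ n * x) < j)%N.
      have x2 : 0 <= 2 ^+ n * x by rewrite mulr_ge0.
      by rewrite truncn_lt_nat// mulrC -ltr_pdivlMr ?pow2_gt0.
    have x1 : 0 <= x < 1.
      rewrite x0 (lt_le_trans xj)// /dyadic ler_pdivrMr ?pow2_gt0//.
      by rewrite mul1r -natrX ler_nat.
    by rewrite /slopes !dyadic_step_in// /c tj.
  have [x1|x1] := boolP (0 <= x < 1); last by rewrite dyadic_step_out.
  rewrite dyadic_step_in// /c; case: ifPn => // tj.
  exfalso; apply: xj; rewrite inE /= in_itv /=.
  case/andP: x1 => x0 x1; rewrite x0 /dyadic ltr_pdivlMr ?pow2_gt0// mulrC.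
  have x2 : 0 <= 2 ^+ n * x by rewrite mulr_ge0.
  by rewrite -truncn_lt_nat.
rewrite dyadic_step_integral; congr EFin.
rewrite (big_cat_nat (n := j))//= [X in _ + X]big1_seq ?addr0; last first.
  by move=> l /= /[!mem_index_iota] /andP[jl _]; rewrite /c ltnNge jl mul0r.
under eq_big_nat => l /andP[_ lj].
  have -> : c l / 2 ^+ n = f (dyadic R n l.+1) - f (dyadic R n l).
    have n0 : 2 ^+ n != 0 :> R by rewrite expf_neq0.
    by rewrite /c lj /slope mulrC mulKf.
  over.
by rewrite telescope_sumr// /dyadic mul0r.
Qed.

End dyadic_energy.

(** * Convergence almost everywhere and null sets *)

Lemma cvgn_EFin (R : realType) (u : nat -> R) (l : R) :
  u n @[n --> \oo] --> l -> ((u n)%:E @[n --> \oo] --> l%:E)%E.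
Proof.
by move=> ul; apply: cvg_EFin => //; near=> n.
Unshelve. all: by end_near. Qed.

Section rapid_L1_convergence.
Context d (T : measurableType d) (R : realType).
Variable mu : {measure set T -> \bar R}.
Variable S : nat -> T -> R.
Hypothesis mS : forall j, measurable_fun setT (S j).
Hypothesis iS0 : mu.-integrable setT (EFin \o S 0%N).
Hypothesis dS : forall j,
  (\int[mu]_x (`|S j.+1 x - S j x|)%:E <= (2^-1 ^+ j)%:E)%E.

Let G x := (\sum_(0 <= j <oo) (`|S j.+1 x - S j x|)%:E)%E.

Let mdS j : measurable_fun setT (fun x => (`|S j.+1 x - S j x|)%:E).
Proof.
by apply/measurable_EFinP; apply: measurableT_comp => //; exact: measurable_funB.
Qed.

Let iG : mu.-integrable setT G.
Proof.
have mG : measurable_fun setT G by apply: ge0_emeasurable_sum.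
have G0 x : (0 <= G x)%E by apply: nneseries_ge0.
apply/integrableP; split => //.
under eq_integral => x _ do rewrite gee0_abs//.
rewrite integral_nneseries//.
apply: (@le_lt_trans _ _ (\sum_(0 <= j <oo) ((2^-1 ^+ j)%:E : \bar R))%E).
  by apply: lee_nneseries => // j _ _; apply: integral_ge0.
suff -> : (\sum_(0 <= j <oo) ((2^-1 ^+ j)%:E : \bar R))%E = 2%:E by rewrite ltry.
apply/cvg_lim => //.
have -> : (fun n => \sum_(0 <= j < n) ((2^-1 ^+ j)%:E : \bar R))%E =
  EFin \o series (geometric 1 2^-1).
  apply/funext => n /=; rewrite sumEFin /series /=.
  by congr EFin; apply: eq_bigr => i _; rewrite mul1r.
apply: cvgn_EFin.
have e2 : 1 / (1 - 2^-1) = 2 :> R by field.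
have h1 : `|2^-1 : R| < 1 by rewrite ger0_norm ?invr_ge0// invf_lt1 ?ltr1n.
by have := @cvg_geometric_series R 1 2^-1 h1; rewrite e2.
Qed.

Let S_bound j x : ((`|S j x|)%:E <= (`|S 0%N x|)%:E + G x)%E.
Proof.
apply: (@le_trans _ _
  ((`|S 0%N x|)%:E + \sum_(0 <= i < j) (`|S i.+1 x - S i x|)%:E)%E).
  rewrite sumEFin -EFinD lee_fin.
  have -> : S j x = S 0%N x + \sum_(0 <= i < j) (S i.+1 x - S i x).
    by rewrite telescope_sumr// subrKC.
  by rewrite (le_trans (ler_normD _ _))// lerD2l ler_norm_sum.
by rewrite leeD2l// nneseries_lim_ge.
Qed.

Let S_cvg x : G x \is a fin_num -> cvgn (fun j => S j x).
Proof.
move=> Gx.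
have -> : (fun j => S j x) =
    (fun n => S 0%N x + series (telescope (fun j => S j x)) n).
  by apply/funext => n; rewrite -eq_sum_telescope.
apply: is_cvgD; first exact: is_cvg_cst.
apply: normed_cvg.
apply: nondecreasing_is_cvgn.
  by apply/nondecreasing_seqP => n; rewrite [leRHS]seriesSr lerDl normr_ge0.
exists (fine (G x)) => _ [n _ <-] /=.
by rewrite -lee_fin fineK// -sumEFin; apply: nneseries_lim_ge.
Qed.

(** Summable L1 distances bound the total variation of the sequence by an
    integrable function, so that the sequence converges almost everywhere and in
    a dominated way. *)
Lemma rapid_L1_convergence : exists g : T -> R,
  [/\ measurable_fun setT g, mu.-integrable setT (EFin \o g),
      {ae mu, forall x, S j x @[j --> \oo] --> g x} &
      forall D, measurable D ->
        (\int[mu]_(x in D) (S j x)%:E @[j --> \oo]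
         --> \int[mu]_(x in D) (g x)%:E)%E].
Proof.
pose g x := fine (limn_esup (fun j => (S j x)%:E)).
have Sg x : G x \is a fin_num -> S j x @[j --> \oo] --> g x.
  move=> /S_cvg /cvg_ex[l Sl]; suff -> : g x = l by [].
  have Sl' : (S j x)%:E @[j --> \oo] --> l%:E by exact: cvgn_EFin.
  by rewrite /g (cvg_limn_einf_sup Sl').
have mg : measurable_fun setT g.
  apply: (measurableT_comp (fine_measurable measurableT)).
  by apply: measurable_fun_limn_esup => j; apply/measurable_EFinP.
have aeG := integrable_ae measurableT iG.
have aeSg : {ae mu, forall x, S j x @[j --> \oo] --> g x}.
  by apply: filterS aeG => x Gx; exact/Sg/Gx.
have iH : mu.-integrable setT (fun x => (`|S 0%N x|)%:E + G x)%E.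
  by apply: integrableD => //; exact: integrable_norm.
have dc D : measurable D -> mu.-integrable D (EFin \o g) /\
    (\int[mu]_(x in D) (S j x)%:E @[j --> \oo]
         --> \int[mu]_(x in D) (g x)%:E)%E.
  move=> mD; have := @dominated_convergence _ _ _ mu D mD
    (fun j x => (S j x)%:E) (EFin \o g) (fun x => (`|S 0%N x|)%:E + G x)%E.
  case=> //.
  - by move=> j; apply/measurable_EFinP; exact: measurable_funTS.
  - by apply/measurable_EFinP; exact: measurable_funTS.
  - apply: filterS aeSg => x h _; exact: cvgn_EFin.
  - exact: integrableS iH.
  - by apply: aeW => x j _; exact: S_bound.
exists g; split => //; first by case: (dc setT measurableT).
by move=> D mD; case: (dc D mD).
Unshelve. all: by end_near. Qed.

End rapid_L1_convergence.

Lemma continuous_within_seq (T U : topologicalType) (A : set T) (f : T -> U)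
    (s : nat -> T) (x : T) :
  {within A, continuous f} -> A x -> (forall n, A (s n)) ->
  s n @[n --> \oo] --> x -> f (s n) @[n --> \oo] --> f x.
Proof.
move=> /subspace_continuousP cf Ax As sx V /(cf x Ax) /sx [n _ VS].
by exists n => // m nm; exact: VS.
Qed.

Import HBNNSimple.

(** The function f is arbitrary because the lemma is applied to a product of two
    pointwise derivatives. It holds because the integral of a nonnegative
    function is a supremum over the simple functions below it, and these can be
    cut off on a null set. *)
Lemma integral_ae_eq_any d (T : measurableType d) (R : realType)
    (mu : {measure set T -> \bar R}) (D : set T) (f g : T -> \bar R) :
  measurable D -> measurable_fun D g ->
  {ae mu, forall x, D x -> f x = g x} ->
  (\int[mu]_(x in D) f x = \int[mu]_(x in D) g x)%E.
Proof.
move=> mD mg [N [mN N0 subN]].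
have ge0 (h1 h2 : T -> \bar R) : (forall x, (0 <= h1 x)%E) ->
    (forall x, (0 <= h2 x)%E) -> measurable_fun setT h2 ->
    (forall x, ~ N x -> h1 x = h2 x) ->
    (\int[mu]_x h1 x = \int[mu]_x h2 x)%E.
  move=> h10 h20 mh2 h12.
  have mNC : measurable (~` N) by exact: measurableC.
  have restr (h : T -> \bar R) : (forall x, (0 <= h x)%E) ->
      measurable_fun setT h ->
      (\int[mu]_x h x = \int[mu]_x (h \_ (~` N)) x)%E.
    move=> h0 mh; apply: ge0_ae_eq_integral => //.
    - by apply/(measurable_restrictT _ mNC).1; exact: measurable_funTS.
    - by move=> x _; apply: erestrict_ge0.
    - exists N; split => // x /= hx; apply: contrapT => Nx; apply: hx => _.
      by rewrite patchE mem_set.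
  apply/eqP; rewrite eq_le; apply/andP; split.
    rewrite !ge0_integralTE//.
    apply: ge_ereal_sup => _ [phi /= phih <-].
    have mphi : measurable_fun setT (EFin \o phi) by exact/measurable_EFinP.
    have phi0 x : (0 <= (phi x)%:E)%E by rewrite lee_fin.
    rewrite -integralT_nnsfun (restr (EFin \o phi))//.
    rewrite -ge0_integralTE//; apply: ge0_le_integral => //.
    - by move=> x _; apply: erestrict_ge0 => y _; exact: phi0.
    - by apply/(measurable_restrictT _ mNC).1; exact: measurable_funTS.
    - move=> x _; rewrite patchE; case: ifPn => // /set_mem Nx.
      by rewrite -h12//; exact: phih.
  rewrite (restr h2)// !ge0_integralTE//; last by move=> x; apply: erestrict_ge0.
  apply: le_ereal_sup => _ [phi /= phih <-]; exists phi => //= x.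
  apply: le_trans (phih x) _; rewrite patchE; case: ifPn => // /set_mem Nx.
  by rewrite h12.
rewrite [LHS]integral_mkcond [RHS]integral_mkcond.
have mgD : measurable_fun setT (g \_ D) by apply/(measurable_restrictT _ mD).1.
have fg x : ~ N x -> (f \_ D) x = (g \_ D) x.
  move=> Nx; rewrite !patchE; case: ifPn => // /set_mem Dx.
  by apply: contrapT => fgx; apply: Nx; apply: subN => /= /(_ Dx).
rewrite [LHS]integralE [RHS]integralE; congr (_ - _)%E; apply: ge0 => //.
- exact: measurable_funepos.
- by move=> x Nx; rewrite !funeposE fg.
- exact: measurable_funeneg.
- by move=> x Nx; rewrite !funenegE fg.
Qed.

(** * Functions of finite dyadic energy *)

Lemma cvgn_sqr (R : realType) (u : nat -> R) (l : R) :
  u n @[n --> \oo] --> l -> u n ^+ 2 @[n --> \oo] --> l ^+ 2.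
Proof. by move=> ul; exact: (cvgM ul ul). Qed.

(** From 2 y z <= e y^2 + z^2 / e. When e tends to 0 more slowly than the
    squared distance of h1 and h2, it bounds the L2 norm of one by that of the
    other up to an error that tends to 0. *)
Lemma L2_compare d (T : measurableType d) (R : realType)
    (mu : {measure set T -> \bar R}) (D : set T) (h1 h2 : T -> R) (e : R) :
  measurable D -> measurable_fun D h1 -> measurable_fun D h2 -> 0 < e ->
  (\int[mu]_(x in D) (h1 x ^+ 2)%:E <=
   (1 + e)%:E * \int[mu]_(x in D) (h2 x ^+ 2)%:E +
   (1 + e^-1)%:E * \int[mu]_(x in D) ((h1 x - h2 x) ^+ 2)%:E)%E.
Proof.
move=> mD mh1 mh2 e0.
have e'0 : 0 < e^-1 by rewrite invr_gt0.
have m1 : measurable_fun D (fun x => (h1 x ^+ 2)%:E).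
  by apply/measurable_EFinP; exact: measurable_funX.
have m2 : measurable_fun D (fun x => (h2 x ^+ 2)%:E).
  by apply/measurable_EFinP; exact: measurable_funX.
have m3 : measurable_fun D (fun x => ((h1 x - h2 x) ^+ 2)%:E).
  apply/measurable_EFinP/measurable_funX; exact: measurable_funB.
have sq (y : R) : (0 <= (y ^+ 2)%:E)%E by rewrite lee_fin sqr_ge0.
rewrite -ge0_integralZl//; last by rewrite lee_fin addr_ge0// ltW.
rewrite -ge0_integralZl//; last by rewrite lee_fin addr_ge0// ltW.
rewrite -ge0_integralD//; first last.
- exact: measurable_funeM.
- by move=> x _; rewrite mule_ge0// lee_fin addr_ge0// ltW.
- exact: measurable_funeM.
- by move=> x _; rewrite mule_ge0// lee_fin addr_ge0// ltW.
apply: ge0_le_integral => //.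
  by apply: emeasurable_funD; exact: measurable_funeM.
move=> x _; rewrite -!EFinM -EFinD lee_fin.
set y := h1 x; set z := h2 x; rewrite -subr_ge0.
have -> : (1 + e) * z ^+ 2 + (1 + e^-1) * (y - z) ^+ 2 - y ^+ 2 =
    e^-1 * (y - z - e * z) ^+ 2 by field; rewrite gt_eqF.
by rewrite mulr_ge0 ?sqr_ge0// ltW.
Qed.

Lemma dyadic_refine (R : realType) p k i :
  dyadic R (p + k) (i * 2 ^ k) = dyadic R p i.
Proof.
rewrite /dyadic exprD natrM natrX.
have n0 j : 2 ^+ j != 0 :> R by rewrite expf_neq0.
by field; rewrite !n0.
Qed.

Section dyadic_derivative.
Variables (R : realType) (f : R -> R).
Notation mu := (@lebesgue_measure R).
Notation A := (dyadic_energy f).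

Lemma dyadic_step_integral01 n c :
  (\int[mu]_(x in `[0%R, 1%R]) (dyadic_step n c x)%:E =
   (\sum_(0 <= l < 2 ^ n) c l / 2 ^+ n)%:E)%E.
Proof.
rewrite integral_mkcond -dyadic_step_integral; apply: eq_integral => x _.
rewrite patchE; case: ifPn => // /negP x01; rewrite dyadic_step_out//.
apply/negP => /andP[x0 x1]; apply: x01; rewrite inE /= in_itv /= x0.
exact: ltW.
Qed.

Lemma slopes_energy n :
  (\int[mu]_(x in `[0%R, 1%R]) (slopes f n x ^+ 2)%:E = (A n)%:E)%E.
Proof.
transitivity (\int[mu]_(x in `[0%R, 1%R])
    (dyadic_step n (fun l => slope f n l * slope f n l) x)%:E)%E.
  apply: eq_integral => x _; congr EFin; rewrite expr2.
  by rewrite (@dyadic_step_comp2 _ n (fun a b => a * b)) ?mul0r.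
by rewrite dyadic_step_integral01.
Qed.

Lemma slopes_comp2 m k (F : R -> R -> R) x : F 0 0 = 0 ->
  F (slopes f (m + k) x) (slopes f m x) =
  dyadic_step (m + k)
    (fun l => F (slope f (m + k) l) (slope f m (l %/ 2 ^ k)%N)) x.
Proof.
by move=> F0; rewrite /slopes (@dyadic_step_refine _ m k) dyadic_step_comp2.
Qed.

Lemma slopes_dist m k :
  (\int[mu]_(x in `[0%R, 1%R]) ((slopes f (m + k) x - slopes f m x) ^+ 2)%:E
   = (A (m + k) - A m)%:E)%E.
Proof.
transitivity (\int[mu]_(x in `[0%R, 1%R]) (dyadic_step (m + k)
    (fun l => (slope f (m + k) l - slope f m (l %/ 2 ^ k)%N) ^+ 2) x)%:E)%E.
  apply: eq_integral => x _; congr EFin.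
  by rewrite (@slopes_comp2 m k (fun a b => (a - b) ^+ 2)) ?subrr ?expr0n.
by rewrite dyadic_step_integral01 slope_dist.
Qed.

(** On an interval of length 1, an L2 bound e gives the L1 bound e; here through
    |y| <= (e + y^2 / e) / 2. *)
Lemma slopes_L1 m k (e : R) : 0 < e -> A (m + k) - A m <= e ^+ 2 ->
  (\int[mu]_x (`|slopes f (m + k) x - slopes f m x|)%:E <= e%:E)%E.
Proof.
move=> e0 Ae.
have -> : (\int[mu]_x (`|slopes f (m + k) x - slopes f m x|)%:E =
    \int[mu]_x (dyadic_step (m + k)
    (fun l => `|slope f (m + k) l - slope f m (l %/ 2 ^ k)%N|) x)%:E)%E.
  apply: eq_integral => x _; congr EFin.
  by rewrite (@slopes_comp2 m k (fun a b => `|a - b|)) ?subrr ?normr0.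
rewrite dyadic_step_integral lee_fin.
have n0 : 0 < 2 ^+ (m + k)%N :> R := pow2_gt0 R _.
have -> : e = \sum_(0 <= l < 2 ^ (m + k)) (e / 2 ^+ (m + k)%N / 2)
    + e^-1 * e ^+ 2 / 2.
  rewrite sumr_const_nat subn0 -[X in _ = X + _]mulr_natl natrX.
  by field; rewrite gt_eqF//= gt_eqF.
apply: (@le_trans _ _ (\sum_(0 <= l < 2 ^ (m + k)) (e / 2 ^+ (m + k)%N / 2)
    + e^-1 * (A (m + k) - A m) / 2)); last first.
  by rewrite lerD2l ler_pM2r// ler_pM2l// invr_gt0.
rewrite -slope_dist mulr_sumr mulr_suml -big_split /=.
apply: ler_sum => l _; set y := slope _ _ _ - _.
suff h : `|y| <= e / 2 + e^-1 * y ^+ 2 / 2.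
  rewrite [leRHS](_ : _ = (e / 2 + e^-1 * y ^+ 2 / 2) / 2 ^+ (m + k)%N).
    by rewrite ler_wpM2r// invr_ge0 ltW.
  by ring.
have h2 : 0 <= (e - `|y|) ^+ 2 / e by rewrite divr_ge0 ?sqr_ge0// ltW.
have h3 : (e - `|y|) ^+ 2 / e = e - `|y| *+ 2 + e^-1 * y ^+ 2.
  by rewrite -[y ^+ 2]real_normK ?num_real//; field; rewrite gt_eqF.
move: h2; rewrite h3; lra.
Qed.

Variable a : R.
Hypothesis cf : {within `[0, 1], continuous f}.
Hypothesis Aa : A n @[n --> \oo] --> a.

Let A_le n : A n <= a.
Proof.
rewrite -(cvg_lim _ Aa)//; apply: nondecreasing_cvgn_le => //.
  exact: dyadic_energy_nd.
by apply/cvg_ex; exists a.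
Qed.

Let subseq_ex : exists k : nat -> nat, [/\ forall j, (k j <= k j.+1)%N,
  forall j, (j <= k j)%N & forall j, a - A (k j) <= (2^-1 ^+ j) ^+ 2].
Proof.
(* The square of 2^-j bounds the increment of energy, so that 2^-j bounds the
   L1 distance. *)
have ex j : exists N, forall n, (N <= n)%N -> a - A n <= (2^-1 ^+ j) ^+ 2.
  have e0 : 0 < (2^-1 ^+ j) ^+ 2 :> R by rewrite !exprn_gt0// invr_gt0.
  move/cvgrPdist_le : Aa => /(_ _ e0)[N _ NA]; exists N => n /NA.
  by rewrite ger0_norm ?subr_ge0.
have [N NP] := choice ex.
(* The summand j makes every dyadic level occur below k j. *)
exists (fun j => j + \sum_(0 <= i < j.+1) N i)%N; split => j.
- by rewrite [leqRHS](_ : _ = (j + \sum_(0 <= i < j.+1) N i + (N j.+1).+1)%N)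
    ?leq_addr// [in LHS]big_nat_recr//=; lia.
- exact: leq_addr.
- by apply: NP; rewrite big_nat_recr//= addnA leq_addl.
Qed.

(** Along levels k j at which the dyadic energy is within 4^-j of its limit, the
    difference quotients are at L1 distance at most 2^-j, so they converge almost
    everywhere to some g. By Fatou's lemma the L2 distance to g is also at most
    2^-j, so the dyadic energies converge to the square integral of g. At a
    dyadic point the integrals of the quotients are eventually constant, and
    continuity extends the formula to the other points. *)
Lemma L2_primitive : exists g : R -> R,
  [/\ measurable_fun setT g, mu.-integrable setT (EFin \o g),
      (\int[mu]_(x in `[0%R, 1%R]) (g x ^+ 2)%:E = a%:E)%E &
      forall x, x \in `[0, 1] -> f x = f 0 + \int[mu]_(t in `[0, x]) g t].
Proof.
have [k [knd jk kA]] := subseq_ex.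
pose e j : R := 2^-1 ^+ j.
have e_gt0 j : 0 < e j by rewrite exprn_gt0// invr_gt0.
have mS j : measurable_fun setT (slopes f (k j)).
  exact: dyadic_step_measurable.
have [g [mg ig aeg cvg_int]] : exists g : R -> R,
    [/\ measurable_fun setT g, mu.-integrable setT (EFin \o g),
      {ae mu, forall x, slopes f (k j) x @[j --> \oo] --> g x} &
      forall D : set R, measurable D ->
        (\int[mu]_(x in D) (slopes f (k j) x)%:E @[j --> \oo]
         --> \int[mu]_(x in D) (g x)%:E)%E].
  apply: (@rapid_L1_convergence _ _ R mu (fun j => slopes f (k j)) mS) => [|j].
    exact: dyadic_step_integrable.
  have -> : k j.+1 = (k j + (k j.+1 - k j))%N by rewrite subnKC.
  apply: slopes_L1 => //.
  by rewrite subnKC//; apply: le_trans (kA j); rewrite lerD2r.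
pose D : set R := `[0%R, 1%R]%classic.
have mD : measurable D by exact: measurable_itv.
have msq (h : R -> R) : measurable_fun setT h ->
    measurable_fun D (fun x : R => (h x ^+ 2)%:E).
  by move=> mh; apply/measurable_EFinP/measurable_funTS; exact: measurable_funX.
have gS j : (\int[mu]_(x in D) ((g x - slopes f (k j) x) ^+ 2)%:E
    <= (e j ^+ 2)%:E)%E.
  have mSS i : measurable_fun D
      (fun x : R => ((slopes f (k (i + j)%N) x - slopes f (k j) x) ^+ 2)%:E).
    by apply: msq; exact: measurable_funB.
  have pSS i x : D x ->
      (0 <= ((slopes f (k (i + j)%N) x - slopes f (k j) x) ^+ 2)%:E)%E.
    by move=> _; rewrite lee_fin sqr_ge0.
  have mgS : measurable_fun D (fun x : R => ((g x - slopes f (k j) x) ^+ 2)%:E).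
    by apply: msq; exact: measurable_funB.
  apply: (le_trans _ (le_trans (fatou mu mD mSS pSS) _)).
    rewrite le_eqVlt; apply/orP; left; apply/eqP/esym.
    apply: integral_ae_eq_any => //.
    apply: (@filterS _ _ (ae_filter_ringOfSetsType mu) _ _ _ aeg) => x Sx _.
    apply: (cvg_limn_einf_sup _).1; apply: cvgn_EFin.
    apply: cvgn_sqr.
    apply: cvgB => //; last exact: cvg_cst.
    by have := Sx; rewrite -(cvg_shiftn j).
  rewrite limn_einf_lim; apply: lime_le; first exact: is_cvg_einfs.
  apply: nearW => i; apply: le_trans.
    by apply: ereal_inf_lbound; exists i => /=.
  have kk : (k j <= k (i + j))%N.
    by elim: i => [//|i IH]; rewrite addSn (leq_trans IH).
  have -> : k (i + j)%N = (k j + (k (i + j) - k j))%N by rewrite subnKC.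
  rewrite slopes_dist lee_fin.
  by rewrite subnKC//; apply: le_trans (kA j); rewrite lerD2r.
have mgD : measurable_fun D g by exact: measurable_funTS.
have mSD j : measurable_fun D (slopes f (k j)) by exact: measurable_funTS.
have ub j : (\int[mu]_(x in D) (g x ^+ 2)%:E <=
    ((1 + e j) * A (k j) + (e j ^+ 2 + e j))%:E)%E.
  apply: le_trans (L2_compare mu mD mgD (mSD j) (e_gt0 j)) _.
  rewrite slopes_energy [leRHS]EFinD [in leRHS]EFinM; apply: leeD2l.
  have -> : e j ^+ 2 + e j = (1 + (e j)^-1) * e j ^+ 2.
    by field; rewrite gt_eqF.
  by rewrite EFinM; apply: lee_wpmul2l => //; rewrite lee_fin addr_ge0// ltW// invr_gt0.
have Gfin : (\int[mu]_(x in D) (g x ^+ 2)%:E)%E \is a fin_num.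
  rewrite ge0_fin_numE; first exact: le_lt_trans (ub 0%N) (ltry _).
  by apply: integral_ge0 => x _; rewrite lee_fin sqr_ge0.
pose G := fine (\int[mu]_(x in D) (g x ^+ 2)%:E)%E.
have ubG j : G <= (1 + e j) * A (k j) + (e j ^+ 2 + e j).
  by rewrite -lee_fin fineK.
have lbG j : A (k j) <= (1 + e j) * G + (e j ^+ 2 + e j).
  have SG : (\int[mu]_(x in D) ((slopes f (k j) x - g x) ^+ 2)%:E
      <= (e j ^+ 2)%:E)%E.
    apply: le_trans (gS j); rewrite le_eqVlt; apply/orP; left; apply/eqP.
    by apply: eq_integral => x _; rewrite -sqrrN opprB.
  have := L2_compare mu mD (mSD j) mgD (e_gt0 j).
  rewrite slopes_energy -lee_fin => /le_trans; apply.
  rewrite -[X in (_ * X + _)%E](fineK Gfin) [leRHS]EFinD [in leRHS]EFinM; apply: leeD2l.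
  have -> : e j ^+ 2 + e j = (1 + (e j)^-1) * e j ^+ 2.
    by field; rewrite gt_eqF.
  by rewrite EFinM; apply: lee_wpmul2l => //; rewrite lee_fin addr_ge0// ltW// invr_gt0.
have ce : e j @[j --> \oo] --> 0.
  by apply: cvg_expr; rewrite ger0_norm ?invr_ge0// invf_lt1 ?ltr1n.
have ce2 : e j ^+ 2 + e j @[j --> \oo] --> 0.
  rewrite -[X in _ --> X](_ : 0 ^+ 2 + 0 = 0); last by rewrite expr0n addr0.
  by apply: cvgD => //; exact: cvgn_sqr.
have ck : A (k j) @[j --> \oo] --> a.
  apply/cvgrPdist_le => eps eps0.
  move/cvgrPdist_le : Aa => /(_ _ eps0)[N _ NA]; exists N => // j /= Nj.
  exact/NA/(leq_trans Nj)/jk.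
have Ga : G = a.
  apply/eqP; rewrite eq_le; apply/andP; split.
    have c : (1 + e j) * A (k j) + (e j ^+ 2 + e j) @[j --> \oo] --> (1 + 0) * a + 0.
      by apply: cvgD => //; apply: cvgM => //; apply: cvgD => //; exact: cvg_cst.
    rewrite addr0 addr0 mul1r in c.
    by apply: (ler_cvg_to _ c (nearW _ ubG)); exact: cvg_cst.
  have c : (1 + e j) * G + (e j ^+ 2 + e j) @[j --> \oo] --> (1 + 0) * G + 0.
    by apply: cvgD => //; apply: cvgM; [apply: cvgD => //|]; exact: cvg_cst.
  rewrite addr0 addr0 mul1r in c.
  exact: (ler_cvg_to ck c (nearW _ lbG)).
have prim_dyadic p i : (i <= 2 ^ p)%N ->
    \int[mu]_(t in `[0, dyadic R p i]) g t = f (dyadic R p i) - f 0.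
  move=> ip; rewrite /Rintegral; set L := (\int[mu]_(_ in _) _)%E.
  suff -> : L = (f (dyadic R p i) - f 0)%:E by [].
  have mI : measurable (`[0, dyadic R p i]%classic : set R).
    exact: measurable_itv.
  apply: (cvg_unique _ (cvg_int _ mI)) => //.
  apply: cvg_near_cst; exists p => // j /= pj.
  have pk : (p <= k j)%N by apply: leq_trans (jk j).
  have -> : dyadic R p i = dyadic R (k j) (i * 2 ^ (k j - p)).
    by rewrite -{1}(subnKC pk) dyadic_refine.
  by rewrite slopes_integral// -[X in (_ <= 2 ^ X)%N](subnKC pk) expnD leq_mul2r ip orbT.
exists g; split => //; first by rewrite -Ga fineK.
move=> x; rewrite in_itv /= => /andP[x0 x1].
pose s p := dyadic R p (Num.truncn (2 ^+ p * x)).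
have sE p : s p <= x /\ x < s p + 2^-1 ^+ p.
  have xp : 0 <= 2 ^+ p * x by rewrite mulr_ge0.
  have /andP[h1 h2] := truncn_itv xp; split.
    by rewrite /s /dyadic ler_pdivrMr ?pow2_gt0// [leRHS]mulrC.
  rewrite /s /dyadic exprVn -[X in _ + X]mul1r -mulrDl natr1.
  by rewrite ltr_pdivlMr ?pow2_gt0// [ltLHS]mulrC.
have tp p : (Num.truncn (2 ^+ p * x) <= 2 ^ p)%N.
  rewrite -(ler_nat R) natrX -(ler_pM2r (x := (2 ^+ p)^-1)) ?invr_gt0 ?pow2_gt0//.
  by rewrite mulfV ?expf_neq0//; apply: le_trans x1; case: (sE p).
have s01 p : `[0, 1]%classic (s p).
  rewrite /= in_itv /= divr_ge0//=.
  by apply: le_trans x1; case: (sE p).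
have sx : s p @[p --> \oo] --> x.
  apply: (@squeeze_cvgr _ _ _ _ (fun p => x - e p) (fun=> x)).
  - by apply: nearW => p; case: (sE p) => h1 h2; rewrite h1 andbT lerBlDr ltW.
  - by rewrite -[X in _ --> X]subr0; apply: cvgB ce; exact: cvg_cst.
  - exact: cvg_cst.
have X01 : `[0, 1]%classic x by rewrite /= in_itv /= x0.
have c1 : f (s p) - f 0 @[p --> \oo] --> f x - f 0.
  apply: cvgB; last exact: cvg_cst.
  exact: (continuous_within_seq cf X01 s01 sx).
have ig01 : mu.-integrable `[0, 1] (EFin \o g) by exact: integrableS ig.
have cP := parameterized_integral_continuous ler01 ig01.
have := continuous_within_seq cP X01 s01 sx.
rewrite /parameterized_integral; under eq_cvg do rewrite prim_dyadic//.
by move=> /(cvg_unique _ c1) <-//; rewrite subrKC.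
Qed.
End dyadic_derivative.

(** Lebesgue's differentiation theorem for the primitive in [L2_primitive]. *)
Lemma dyadic_derivative (R : realType) (f : R -> R) (a : R) :
  {within `[0, 1], continuous f} ->
  dyadic_energy f n @[n --> \oo] --> a ->
  exists g : R -> R,
  [/\ measurable_fun setT g,
      (\int[@lebesgue_measure R]_(x in `[0%R, 1%R]) (g x ^+ 2)%:E = a%:E)%E &
      {ae @lebesgue_measure R, forall x, 0 < x < 1 ->
         derivable f x 1 /\ derive1 f x = g x}].
Proof.
move=> cf Aa; have [g [mg ig ga fE]] := L2_primitive cf Aa.
exists g; split => //.
have locg : locally_integrable setT g.
  by apply: open_integrable_locally => //; exact: openT.
have intg (y : R) : (@lebesgue_measure R).-integrable
    [set` Interval (BLeft 0) (BRight y)] (EFin \o g) by exact: integrableS ig.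
have := FTC1 intg locg.
apply: (@filterS _ _ (ae_filter_ringOfSetsType _)) => x /= Fx /andP[x0 x1].
have [] := Fx; first by rewrite lte_fin.
set F := (F in derivable F _ _) => dF F'.
have nearf : \forall y \near x, (cst (f 0) + F) y = f y.
  near=> y; rewrite [RHS]fE//.
  by rewrite in_itv /=; apply/andP; split; apply: ltW; near: y;
    [exact: lt_nbhsr|exact: lt_nbhsl].
have dG : derivable (cst (f 0) + F) x 1 by apply: derivableD.
split; first by apply: near_eq_derivable dG.
rewrite derive1E -(@near_eq_derive R R R _ _ x 1 nearf) deriveD// derive_cst add0r.
by rewrite -derive1E.
Unshelve. all: by end_near. Qed.

Definition dyadic_form (R : realType) (u v : R -> R) (n : nat) : R :=
  \sum_(0 <= l < 2 ^ n) slope u n l * slope v n l / 2 ^+ n.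

Lemma dyadic_energyD (R : realType) (u v : R -> R) n :
  dyadic_energy (u \+ v) n =
  dyadic_energy u n + dyadic_energy v n + 2 * dyadic_form u v n.
Proof.
rewrite /dyadic_energy /dyadic_form mulr_sumr -!big_split /=.
by apply: eq_bigr => l _; rewrite /slope /=; ring.
Qed.

(** By polarization: the derivative of u + v is the sum of the derivatives almost
    everywhere, and its square integral is known by [dyadic_derivative] applied
    to u + v. *)
Lemma cvg_dyadic_form (R : realType) (u v : R -> R) :
  {within `[0, 1], continuous u} -> {within `[0, 1], continuous v} ->
  cvgn (dyadic_energy u) -> cvgn (dyadic_energy v) ->
  dyadic_form u v n @[n --> \oo] -->
  \int[@lebesgue_measure R]_(t in `[0, 1]) (derive1 u t * derive1 v t).
Proof.
move=> cu cv /cvg_ex[a ua] /cvg_ex[b vb].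
have cw : {within `[0, 1], continuous (u \+ v)}.
  by move=> x; apply: cvgD; [exact: cu|exact: cv].
have leab n : dyadic_energy u n <= a /\ dyadic_energy v n <= b.
  split; [rewrite -(cvg_lim _ ua)//|rewrite -(cvg_lim _ vb)//];
    apply: nondecreasing_cvgn_le; do ?exact: dyadic_energy_nd;
    by apply/cvg_ex; eexists; eassumption.
have : cvgn (dyadic_energy (u \+ v)).
  apply: nondecreasing_is_cvgn; first exact: dyadic_energy_nd.
  exists (2 * a + 2 * b) => _ [n _ <-].
  have [h1 h2] := leab n.
  apply: (@le_trans _ _ (2 * dyadic_energy u n + 2 * dyadic_energy v n)).
    rewrite /dyadic_energy !mulr_sumr -big_split /=; apply: ler_sum => l _.
    rewrite -subr_ge0.
    have -> : 2 * (slope u n l ^+ 2 / 2 ^+ n) + 2 * (slope v n l ^+ 2 / 2 ^+ n)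
      - slope (u \+ v) n l ^+ 2 / 2 ^+ n =
      (slope u n l - slope v n l) ^+ 2 / 2 ^+ n by rewrite /slope /=; ring.
    by rewrite divr_ge0 ?sqr_ge0.
  by rewrite lerD// ler_pM2l.
move=> /cvg_ex[c wc].
have [g [mg ga ug]] := dyadic_derivative cu ua.
have [h [mh hb vh]] := dyadic_derivative cv vb.
have [k [mk kc wk]] := dyadic_derivative cw wc.
have -> : dyadic_form u v = fun n => 2^-1 * (dyadic_energy (u \+ v) n -
    dyadic_energy u n - dyadic_energy v n).
  by apply/funext => n; rewrite dyadic_energyD; field.
suff -> : \int[lebesgue_measure]_(t in `[0, 1]) (derive1 u t * derive1 v t) =
    2^-1 * (c - a - b).
  by apply: cvgM; [exact: cvg_cst|apply: cvgB => //; apply: cvgB].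
have mD : measurable (`[0, 1]%classic : set R) by exact: measurable_itv.
have isq (p : R -> R) (e : R) : measurable_fun setT p ->
    (\int[@lebesgue_measure R]_(x in `[0%R, 1%R]) (p x ^+ 2)%:E = e%:E)%E ->
    (@lebesgue_measure R).-integrable `[0, 1] (fun x => (p x ^+ 2)%:E).
  move=> mp pe; apply/integrableP; split.
    by apply/measurable_EFinP/measurable_funTS; exact: measurable_funX.
  rewrite (_ : (\int[_]_(_ in _) _ = e%:E)%E) ?ltry//.
  rewrite -pe; apply: eq_integral => x _.
  by rewrite gee0_abs// lee_fin sqr_ge0.
have ig := isq _ _ mg ga; have ih := isq _ _ mh hb; have ik := isq _ _ mk kc.
rewrite /Rintegral.
transitivity (fine (\int[@lebesgue_measure R]_(x in `[0%R, 1%R])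
  (2^-1%:E * (((k x ^+ 2)%:E - (g x ^+ 2)%:E) - (h x ^+ 2)%:E)))%E); last first.
  rewrite integralZl//; last by apply: integrableB => //; exact: integrableB.
  rewrite integralB//; last exact: integrableB.
  by rewrite integralB// kc ga hb -!EFinB -EFinM.
congr fine; apply: integral_ae_eq_any => //.
  apply: measurable_funeM; apply: (measurable_int lebesgue_measure).
  by apply: integrableB => //; exact: integrableB.
have n0 (p : R) : {ae @lebesgue_measure R, forall x, x <> p}.
  exists [set p]; split => //; first exact: lebesgue_measure_set1.
  by move=> x /= /contrapT.
have F := ae_filter_ringOfSetsType (@lebesgue_measure R).
have := @filterI _ _ F _ _ (@filterI _ _ F _ _ (n0 0) (n0 1))
  (@filterI _ _ F _ _ ug (@filterI _ _ F _ _ vh wk)).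
apply: (@filterS _ _ F) => x [[x0 x1] [ugx [vhx wkx]]].
rewrite /= in_itv /= => /andP[x0' x1'].
have x01 : 0 < x < 1.
  by rewrite !lt_neqAle x0' x1' !andbT; apply/andP; split; apply/eqP => // /esym.
have [du uE] := ugx x01; have [dv vE] := vhx x01; have [_ wE] := wkx x01.
have kE : k x = g x + h x.
  by rewrite -wE -uE -vE !derive1E deriveD.
by rewrite uE vE kE -!EFinB -EFinM; congr EFin; field.
Qed.

(** * The network of one cell *)

Section network.
Variable R : realFieldType.
Implicit Types x y z e : R.

Definition tri (x y z : R) : R := (x - y) ^+ 2 + (x - z) ^+ 2 + (y - z) ^+ 2.

Lemma tri_ge0 x y z : 0 <= tri x y z.
Proof. by rewrite /tri !addr_ge0 ?sqr_ge0. Qed.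

(** Thomson's principle for a triangle whose edges have conductance w: currents
    e1, e2, e3 of sum 0 that enter at the vertices give a lower bound of the
    energy, by completing squares with the edge currents (ei - ej) / 3. *)
Lemma tri_thomson (w x y z e1 e2 e3 : R) : 0 < w -> e1 + e2 + e3 = 0 ->
  2 * (e1 * x + e2 * y + e3 * z) - (e1 ^+ 2 + e2 ^+ 2 + e3 ^+ 2) / (3 * w)
  <= w * tri x y z.
Proof.
move=> w0 e0; have -> : e3 = - e1 - e2 by lra.
rewrite -subr_ge0.
have -> : w * tri x y z - (2 * (e1 * x + e2 * y + (- e1 - e2) * z) -
    (e1 ^+ 2 + e2 ^+ 2 + (- e1 - e2) ^+ 2) / (3 * w)) =
  w * ((x - y - (e1 - e2) / (3 * w)) ^+ 2
     + (x - z - (e1 + e1 + e2) / (3 * w)) ^+ 2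
     + (y - z - (e2 + e1 + e2) / (3 * w)) ^+ 2).
  by rewrite /tri; field; rewrite gt_eqF.
by rewrite mulr_ge0 ?(ltW w0)// !addr_ge0 ?sqr_ge0.
Qed.

Lemma edge_thomson (w x y e : R) : 0 < w ->
  2 * (e * (x - y)) - e ^+ 2 / w <= w * (x - y) ^+ 2.
Proof.
move=> w0; rewrite -subr_ge0.
have -> : w * (x - y) ^+ 2 - (2 * (e * (x - y)) - e ^+ 2 / w) =
  w * (x - y - e / w) ^+ 2 by field; rewrite gt_eqF.
by rewrite mulr_ge0 ?(ltW w0)// sqr_ge0.
Qed.

(** A current that enters a corner cell splits between its two segments. With
    currents I1, I2, I3 of sum 0 at the three corners, symmetry forces the segment
    from corner i towards corner j to carry p I_i - t I_j with 2 p + t = 1. The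
    ratio t below minimizes the dissipation when the cells have resistance
    rho. *)
Definition split_ratio (rho : R) : R := (1 + rho) / (9 + 7 * rho).

(** The energy that the flow dissipates in the six segments and in the gasket, all
    of resistance 1, divided by I1^2 + I2^2 + I3^2. *)
Definition loss (rho : R) : R :=
  let t := split_ratio rho in let p := (1 - t) / 2 in
  2 * p ^+ 2 + 2 * t ^+ 2 + 2 * p * t + (p - t) ^+ 2 / 3.

Lemma loss_gt0 rho : 0 < rho -> 0 < loss rho.
Proof.
move=> rho0; rewrite /loss; set t := split_ratio rho.
have t0 : 0 < t by rewrite divr_gt0//; lra.
have -> : 2 * ((1 - t) / 2) ^+ 2 + 2 * t ^+ 2 + 2 * ((1 - t) / 2) * t
  + ((1 - t) / 2 - t) ^+ 2 / 3 = (1 - t) ^+ 2 / 2 + t + t ^+ 2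
  + ((1 - t) / 2 - t) ^+ 2 / 3 by field.
have h1 := sqr_ge0 (1 - t); have h2 := sqr_ge0 t.
have h3 := sqr_ge0 ((1 - t) / 2 - t).
lra.
Qed.

(** Here xij is the potential at the j-th corner of the i-th cell, and lam is the
    conductance of the links. The flow dissipates as much as the triangle of
    resistance Rc when lam is 1: this is the equation that links Rc and rho. When
    lam is larger, the links dissipate less by the factor 1 / lam, and the bound
    improves by that amount. *)
Lemma network_bound (Rc rho lam : R)
    (x00 x01 x02 x10 x11 x12 x20 x21 x22 : R)
    (x30 x31 x32 x40 x41 x42 x50 x51 x52 : R) :
  0 < Rc -> 0 < rho -> 0 < lam ->
  Rc * (9 + 7 * rho) = rho * (9 + 7 * rho) + (3 + 2 * rho) * (5 + 4 * rho) ->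
  (1 + (1 - lam^-1) * (3 / Rc * loss rho)) * (Rc^-1 * tri x00 x11 x22) <=
  rho^-1 * (tri x00 x01 x02 + tri x10 x11 x12 + tri x20 x21 x22
          + tri x30 x31 x32 + tri x40 x41 x42 + tri x50 x51 x52)
  + lam * ((x01 - x30) ^+ 2 + (x02 - x40) ^+ 2 + (x10 - x31) ^+ 2
         + (x12 - x51) ^+ 2 + (x20 - x42) ^+ 2 + (x21 - x52) ^+ 2
         + tri x32 x50 x41).
Proof.
move=> R0 rho0 lam0 RE.
have rho'0 : 0 < rho^-1 by rewrite invr_gt0.
pose t := split_ratio rho; pose p := (1 - t) / 2.
(* I0, I1, I2 are the currents of the equivalent triangle of resistance Rc. *)
pose I0 := (2 * x00 - x11 - x22) / Rc.
pose I1 := (2 * x11 - x00 - x22) / Rc.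
pose I2 := - I0 - I1.
pose Q := I0 ^+ 2 + I1 ^+ 2 + I2 ^+ 2.
have QE : Rc^-1 * tri x00 x11 x22 = Rc / 3 * Q.
  by rewrite /Q /I2 /I0 /I1 /tri; field; rewrite gt_eqF.
have lin : I0 * x00 + I1 * x11 + I2 * x22 = Rc / 3 * Q.
  by rewrite /Q /I2 /I0 /I1; field; rewrite gt_eqF.
(* Jij flows from the corner cell i towards corner j, and Kij from the middle
   cell of i and j into the gasket. *)
pose J01 := p * I0 - t * I1; pose J02 := p * I0 - t * I2.
pose J10 := p * I1 - t * I0; pose J12 := p * I1 - t * I2.
pose J20 := p * I2 - t * I0; pose J21 := p * I2 - t * I1.
pose K01 := J01 + J10; pose K02 := J02 + J20; pose K12 := J12 + J21.
have J0E : I0 - J01 - J02 = 0 by rewrite /J01 /J02 /I2 /p; field.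
have J1E : - J10 + I1 - J12 = 0 by rewrite /J10 /J12 /I2 /p; field.
have J2E : - J20 - J21 + I2 = 0 by rewrite /J20 /J21 /I2 /p; field.
have KE : K01 + K12 + K02 = 0.
  by rewrite /K01 /K12 /K02 /J01 /J02 /J10 /J12 /J20 /J21 /I2 /p; field.
have c0 := @tri_thomson rho^-1 x00 x01 x02 I0 (- J01) (- J02) rho'0 J0E.
have c1 := @tri_thomson rho^-1 x10 x11 x12 (- J10) I1 (- J12) rho'0 J1E.
have c2 := @tri_thomson rho^-1 x20 x21 x22 (- J20) (- J21) I2 rho'0 J2E.
have c3 := @tri_thomson rho^-1 x30 x31 x32 J01 J10 (- K01) rho'0 (subrr _).
have c4 := @tri_thomson rho^-1 x40 x41 x42 J02 (- K02) J20 rho'0.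
have {c4} := c4 (ltac:(rewrite /K02; ring)) => c4.
have c5 := @tri_thomson rho^-1 x50 x51 x52 (- K12) J12 J21 rho'0.
have {c5} := c5 (ltac:(rewrite /K12; ring)) => c5.
have c6 := @tri_thomson lam x32 x50 x41 K01 K12 K02 lam0 KE.
have s01 := @edge_thomson lam x01 x30 J01 lam0.
have s02 := @edge_thomson lam x02 x40 J02 lam0.
have s10 := @edge_thomson lam x10 x31 J10 lam0.
have s12 := @edge_thomson lam x12 x51 J12 lam0.
have s20 := @edge_thomson lam x20 x42 J20 lam0.
have s21 := @edge_thomson lam x21 x52 J21 lam0.
pose SJ := J01 ^+ 2 + J02 ^+ 2 + J10 ^+ 2 + J12 ^+ 2 + J20 ^+ 2 + J21 ^+ 2.
pose SK := K01 ^+ 2 + K02 ^+ 2 + K12 ^+ 2.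
have SJE : SJ = (2 * p ^+ 2 + 2 * t ^+ 2 + 2 * p * t) * Q.
  by rewrite /SJ /J01 /J02 /J10 /J12 /J20 /J21 /Q /I2; ring.
have SKE : SK = (p - t) ^+ 2 * Q.
  by rewrite /SK /K01 /K02 /K12 /J01 /J02 /J10 /J12 /J20 /J21 /Q /I2; ring.
have main : 2 * (Rc / 3 * Q)
    - (rho / 3 * (Q + 2 * SJ + SK) + lam^-1 * (SJ + SK / 3)) <=
  rho^-1 * (tri x00 x01 x02 + tri x10 x11 x12 + tri x20 x21 x22
          + tri x30 x31 x32 + tri x40 x41 x42 + tri x50 x51 x52)
  + lam * ((x01 - x30) ^+ 2 + (x02 - x40) ^+ 2 + (x10 - x31) ^+ 2
         + (x12 - x51) ^+ 2 + (x20 - x42) ^+ 2 + (x21 - x52) ^+ 2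
         + tri x32 x50 x41).
  rewrite -lin.
  (* By Kirchhoff's law all potentials cancel but those at the three corners. *)
  have := lerD (lerD (lerD (lerD c0 c1) (lerD c2 c3)) (lerD (lerD c4 c5) c6))
     (lerD (lerD (lerD s01 s02) (lerD s10 s12)) (lerD s20 s21)).
  set A := (X in X <= _ -> _); set B := (X in _ <= X -> _).
  move=> AB.
  have -> : 2 * (I0 * x00 + I1 * x11 + I2 * x22)
    - (rho / 3 * (Q + 2 * SJ + SK) + lam^-1 * (SJ + SK / 3)) = A.
    rewrite /A /SJ /SK /Q /K01 /K02 /K12; field.
    by rewrite !gt_eqF.
  apply: le_trans AB _; rewrite le_eqVlt; apply/orP; left; apply/eqP.
  by rewrite /B; ring.
apply: le_trans main; rewrite QE SJE SKE.
have d0 : 9 + 7 * rho != 0 by rewrite gt_eqF//; lra.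
have RcE : Rc = rho + (3 + 2 * rho) * (5 + 4 * rho) / (9 + 7 * rho).
  by apply: (mulIf d0); rewrite RE; field.
have ident : Rc / 3 = rho / 3 + (1 + 2 * rho / 3) *
    (2 * p ^+ 2 + 2 * t ^+ 2 + 2 * p * t) + (1 + rho) / 3 * (p - t) ^+ 2.
  by rewrite RcE /p /t /split_ratio; field.
have lossE : loss rho = 2 * p ^+ 2 + 2 * t ^+ 2 + 2 * p * t + (p - t) ^+ 2 / 3.
  by [].
rewrite le_eqVlt; apply/orP; left; apply/eqP.
rewrite mulrDl mul1r lossE.
set S := 2 * p ^+ 2 + 2 * t ^+ 2 + 2 * p * t in ident *.
set P := (p - t) ^+ 2 in ident *.
have -> : (1 - lam^-1) * (3 / Rc * (S + P / 3)) * (Rc / 3 * Q) =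
  (1 - lam^-1) * (S + P / 3) * Q by field; rewrite !gt_eqF.
rewrite ident; field; by rewrite gt_eqF.
Qed.

End network.

Section renormalized_resistance.
Variables (R : realType) (r : R).
Hypothesis hr : 0 < r < 7 / 15.
Notation Rc := (Rconst r).

Let disc_gt : `|9 - 31 * r| < Num.sqrt (81 + r * (61 * r - 138)).
Proof.
case/andP: hr => r0 r7.
rewrite -sqrtr_sqr ltr_sqrt.
  rewrite -subr_gt0.
  have -> : 81 + r * (61 * r - 138) - (9 - 31 * r) ^+ 2 =
    60 * (r * (7 - 15 * r)) by ring.
  by rewrite mulr_gt0// mulr_gt0//; lra.
have -> : 81 + r * (61 * r - 138) = (9 - 31 * r) ^+ 2 + 60 * (r * (7 - 15 * r)).
  by ring.
by rewrite ltr_wpDl ?sqr_ge0// mulr_gt0// mulr_gt0//; lra.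
Qed.

Let den_gt0 : 0 < 9 - 31 * r + Num.sqrt (81 + r * (61 * r - 138)).
Proof. by move: disc_gt; rewrite ltr_norml => /andP[h _]; lra. Qed.

Lemma Rconst_gt0 : 0 < Rc.
Proof. by rewrite divr_gt0. Qed.

(** With rho = Rc r, the equation amounts to the quadratic equation
    r (7 - 15 r) Rc^2 + (9 - 31 r) Rc = 15, of which Rc is the positive root. *)
Lemma Rconst_fixpoint : let rho := Rc * r in
  Rc * (9 + 7 * rho) = rho * (9 + 7 * rho) + (3 + 2 * rho) * (5 + 4 * rho).
Proof.
case/andP: (hr) => r0 r7 /=.
rewrite /Rconst; set S := Num.sqrt _.
have SE : S ^+ 2 = 81 + r * (61 * r - 138).
  rewrite sqr_sqrtr//.
  have -> : 81 + r * (61 * r - 138) = (9 - 31 * r) ^+ 2 + 60 * (r * (7 - 15 * r)).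
    by ring.
  by rewrite addr_ge0 ?sqr_ge0// mulr_ge0// mulr_ge0//; lra.
have d0 : 9 - 31 * r + S != 0 by rewrite gt_eqF.
apply/eqP; rewrite -subr_eq0; apply/eqP.
transitivity ((15 * (81 + r * (61 * r - 138) - S ^+ 2)) / (9 - 31 * r + S) ^+ 2).
  by field.
by rewrite SE subrr mulr0 mul0r.
Qed.

End renormalized_resistance.

(** * Self-similar decomposition of the energies *)

Section energy_decomposition.
Variables (R : realType) (q : 'I_3 -> plane R) (s r : R).
Implicit Types (u v : plane R -> R).
Implicit Types (F G : (plane R -> R) -> (plane R -> R) -> R).

Definition incr_form (es : seq (plane R * plane R)) u v : R :=
  \sum_(e <- es) (u e.1 - u e.2) * (v e.1 - v e.2).

Definition triangle_form u v : R :=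
  (Rconst r)^-1 * incr_form (triangle_edges q) u v.

Definition segment_form (m : nat) (ij : 'I_3 * 'I_3) u v : R :=
  2 ^+ m * incr_form (segment_edges (seg_a q s ij) (seg_b q s ij) m) u v.

Definition gasket_form (m : nat) u v : R :=
  (5 / 3) ^+ m * incr_form (gasket_edges (sg_vertex q s) m) u v.

(** The links are the segments and the gasket of J; their graphs have level m. *)
Definition link_form (m : nat) u v : R :=
  \sum_(ij : 'I_3 * 'I_3 | ij.1 != ij.2) segment_form m ij u v
  + gasket_form m u v.

(** The form transported to the six first-level cells. Its iterates give the
    energies at all depths, with the weights r^-n, and turn every statement on
    words into an induction that peels off the outermost cell. *)
Definition cell_sum F u v : R :=
  r^-1 * \sum_(i < 6) F (u \o phi q s i) (v \o phi q s i).

Lemma graph_form_image f rho es u v :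
  graph_form [seq image_edge f rho e | e <- es] u v =
  rho^-1 * incr_form es (u \o f) (v \o f).
Proof.
rewrite /graph_form big_map /incr_form mulr_sumr.
by apply: eq_bigr => e _; rewrite /image_edge /= mulrA.
Qed.

Lemma sum_tupleS (I : finType) n (F : n.+1.-tuple I -> R) :
  \sum_(a : n.+1.-tuple I) F a =
  \sum_(i : I) \sum_(b : n.-tuple I) F [tuple of i :: b].
Proof.
rewrite pair_big /=.
rewrite (reindex (fun p : I * n.-tuple I => [tuple of p.1 :: p.2]))//.
exists (fun a : n.+1.-tuple I => (thead a, [tuple of behead a])) => /=.
  by move=> [i b] _; rewrite theadE; congr (_, _); exact: val_inj.
by move=> a _; rewrite [RHS]tuple_eta.
Qed.

Lemma iter_cell_sum n F u v :
  iter n cell_sum F u v =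
  r ^- n * \sum_(a : n.-tuple 'I_6) F (u \o phiw q s a) (v \o phiw q s a).
Proof.
elim: n u v => [|n IH] u v.
  rewrite expr0 invr1 mul1r (bigD1 [tuple])//= big1 ?addr0//.
  by case=> [[|? ?] ?] //= /negP[]; apply/eqP/val_inj.
rewrite iterS /cell_sum sum_tupleS exprS invfM -mulrA; congr (_ * _).
rewrite mulr_sumr; apply: eq_bigr => i _.
by rewrite IH.
Qed.

Lemma En_decomp n u v :
  En q s r n u v = iter n cell_sum triangle_form u v
  + \sum_(0 <= k < n) iter k cell_sum (link_form (n.-1 - k)) u v.
Proof.
rewrite /En /Gamma /graph_form !big_cat /=; congr (_ + _).
  rewrite iter_cell_sum /cell_wedges -/(graph_form _ u v).
  rewrite /graph_form big_allpairs_dep big_enum /= mulr_sumr.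
  apply: eq_bigr => a _.
  rewrite -(big_map (image_edge (phiw q s a) (Rconst r * r ^+ n)) xpredT
    (fun e => e.2^-1 * (u e.1.1 - u e.1.2) * (v e.1.1 - v e.1.2))).
  rewrite -/(graph_form _ u v) graph_form_image /triangle_form mulrA.
  by rewrite invfM (mulrC (r ^- n)).
have E1 (k : nat) (es : nat -> seq (plane R * plane R)) (c : R) :
  \sum_(e <- [seq image_edge (phiw q s a) (r ^+ k * c ^+ (n - k.+1)) e
     | a <- enum {: k.-tuple 'I_6}, e <- es (n - k.+1)%N])
    e.2^-1 * (u e.1.1 - u e.1.2) * (v e.1.1 - v e.1.2) =
  r ^- k * \sum_(a : k.-tuple 'I_6) (c^-1 ^+ (n.-1 - k)) *
     incr_form (es (n.-1 - k)%N) (u \o phiw q s a) (v \o phiw q s a).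
  rewrite big_allpairs_dep big_enum /= mulr_sumr.
  apply: eq_bigr => a _.
  rewrite -(big_map (image_edge (phiw q s a) (r ^+ k * c ^+ (n - k.+1))) xpredT
    (fun e => e.2^-1 * (u e.1.1 - u e.1.2) * (v e.1.1 - v e.1.2))).
  rewrite -/(graph_form _ u v) graph_form_image.
  have -> : (n - k.+1 = n.-1 - k)%N by rewrite -subn1 -subnDA add1n.
  by rewrite invfM exprVn mulrA.
rewrite !big_flatten /= !big_map.
rewrite !(iotaDl 1 0 n) !big_map -big_split /=.
rewrite -[X in iota 0 X]subn0 -/(index_iota 0 n).
apply: eq_bigr => k _.
rewrite iter_cell_sum /link_form big_split /= mulrDr; congr (_ + _); last first.
  rewrite /gasket_wedges add1n /= E1; congr (_ * _).
  by apply: eq_bigr => a _; rewrite /gasket_form invf_div.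
rewrite exchange_big /= mulr_sumr big_map big_enum /=.
apply: eq_bigr => ij _.
rewrite /segment_wedges add1n /= E1; congr (_ * _).
by apply: eq_bigr => a _; rewrite /segment_form invrK.
Qed.

End energy_decomposition.

(** * Monotonicity and the trace inequality *)

Lemma sum_ord3 (V : nmodType) (F : 'I_3 -> V) :
  \sum_(i < 3) F i = F 0 + F 1 + F 2.
Proof.
rewrite !big_ord_recl big_ord0 addr0 addrA.
by congr (F _ + F _ + F _); exact: val_inj.
Qed.

Lemma sum_ord6 (V : nmodType) (F : 'I_6 -> V) :
  \sum_(i < 6) F i = F 0 + F 1 + F 2 + F 3 + F 4 + F 5.
Proof.
rewrite !big_ord_recl big_ord0 addr0 !addrA.
by congr (F _ + F _ + F _ + F _ + F _ + F _); exact: val_inj.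
Qed.

Lemma sum_ordered_pairs (V : nmodType) (F : 'I_3 * 'I_3 -> V) :
  \sum_(ij : 'I_3 * 'I_3 | ij.1 != ij.2) F ij =
  F (0, 1) + F (0, 2) + F (1, 0) + F (1, 2) + F (2, 0) + F (2, 1).
Proof.
rewrite (eq_bigr (fun ij => F (ij.1, ij.2))); last by case.
rewrite -(pair_big_dep xpredT (fun i j : 'I_3 => i != j) (fun i j => F (i, j))).
rewrite /= sum_ord3 big_mkcond [X in _ + X + _]big_mkcond [X in _ + X]big_mkcond.
rewrite !sum_ord3 /=.
by rewrite !add0r !addr0 !addrA.
Qed.

Section centers.
Variables (R : realType) (q : 'I_3 -> plane R) (s : R).

Lemma centerE : (center q 0 = q 0) * (center q 1 = q 1) * (center q 2 = q 2)
  * (center q 3 = midpoint (q 0) (q 1)) * (center q 4 = midpoint (q 0) (q 2))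
  * (center q 5 = midpoint (q 1) (q 2)).
Proof. by []. Qed.

Lemma midpointC (x y : plane R) : midpoint x y = midpoint y x.
Proof. by rewrite /midpoint addrC. Qed.

Lemma similxx (x : plane R) : simil s x x = x.
Proof. by rewrite /simil -scalerDl subrKC scale1r. Qed.

Lemma seg_aE : (seg_a q s (0, 1) = phi q s 0 (q 1))
  * (seg_a q s (0, 2) = phi q s 0 (q 2)) * (seg_a q s (1, 0) = phi q s 1 (q 0))
  * (seg_a q s (1, 2) = phi q s 1 (q 2)) * (seg_a q s (2, 0) = phi q s 2 (q 0))
  * (seg_a q s (2, 1) = phi q s 2 (q 1)).
Proof. by rewrite /phi !centerE. Qed.

Lemma seg_bE : (seg_b q s (0, 1) = phi q s 3 (q 0))
  * (seg_b q s (0, 2) = phi q s 4 (q 0)) * (seg_b q s (1, 0) = phi q s 3 (q 1))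
  * (seg_b q s (1, 2) = phi q s 5 (q 1)) * (seg_b q s (2, 0) = phi q s 4 (q 2))
  * (seg_b q s (2, 1) = phi q s 5 (q 2)).
Proof.
rewrite /phi !centerE /seg_b /=.
by rewrite (midpointC (q 1) (q 0)) (midpointC (q 2) (q 0)) (midpointC (q 2) (q 1)).
Qed.

Lemma sg_vertexE : (sg_vertex q s 0 = phi q s 3 (q 2))
  * (sg_vertex q s 1 = phi q s 5 (q 0)) * (sg_vertex q s 2 = phi q s 4 (q 1)).
Proof. by rewrite /phi !centerE. Qed.

Lemma phi_vertex : (phi q s 0 (q 0) = q 0) * (phi q s 1 (q 1) = q 1)
  * (phi q s 2 (q 2) = q 2).
Proof. by rewrite /phi !centerE !similxx. Qed.

End centers.

Section energy_forms.
Variable R : realType.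
Implicit Types (u v : plane R -> R).
Implicit Types (F G : (plane R -> R) -> (plane R -> R) -> R).

(** The part of symmetric bilinearity that the proof uses. It passes to sums and
    to [cell_sum], and reduces the forms to their diagonals. *)
Definition polar F : Prop := forall u v,
  F (u \+ v) (u \+ v) = F u u + F v v + 2 * F u v /\
  F (u \- v) (u \- v) = F u u + F v v - 2 * F u v.

Definition nonneg F : Prop := forall u, 0 <= F u u.

Lemma incr_form_polar es : polar (@incr_form R es).
Proof.
move=> u v; rewrite /incr_form !mulr_sumr -sumrN -!big_split /=.
by split; apply: eq_bigr => e _; ring.
Qed.

Lemma incr_form_ge0 es : nonneg (@incr_form R es).
Proof. by move=> u; apply: sumr_ge0 => e _; rewrite -expr2 sqr_ge0. Qed.

Lemma polarD F G : polar F -> polar G -> polar (fun u v => F u v + G u v).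
Proof.
by move=> pF pG u v; have [-> ->] := pF u v; have [-> ->] := pG u v; split; ring.
Qed.

Lemma polarZ c F : polar F -> polar (fun u v => c * F u v).
Proof. by move=> pF u v; have [-> ->] := pF u v; split; ring. Qed.

Lemma polar_sum (I : Type) (l : seq I) (P : pred I) (F : I -> _) :
  (forall i, P i -> polar (F i)) ->
  polar (fun u v => \sum_(i <- l | P i) F i u v).
Proof.
move=> pF u v; rewrite !mulr_sumr -sumrN -!big_split /=.
by split; apply: eq_bigr => i Pi; have [? ?] := pF i Pi u v.
Qed.

Lemma nonnegD F G : nonneg F -> nonneg G -> nonneg (fun u v => F u v + G u v).
Proof. by move=> pF pG u; rewrite addr_ge0. Qed.

Lemma polar_le2 F u v : polar F -> nonneg F ->
  F (u \+ v) (u \+ v) <= 2 * F u u + 2 * F v v /\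
  F (u \- v) (u \- v) <= 2 * F u u + 2 * F v v.
Proof.
move=> pF F0; have [h1 h2] := pF u v.
have := F0 (u \+ v); have := F0 (u \- v); rewrite h1 h2; lra.
Qed.

Variables (q : 'I_3 -> plane R) (s r : R).
Hypothesis hr : 0 < r < 7 / 15.
Notation cells := (cell_sum q s r).
Notation links := (link_form q s).
Notation T := (triangle_form q r).
Notation En := (En q s r).

Let r_gt0 : 0 < r. Proof. by case/andP: hr. Qed.

Lemma cell_sum_polar F : polar F -> polar (cells F).
Proof.
move=> pF; apply: polarZ; apply: polar_sum => i _ u v.
exact: (pF (u \o phi q s i) (v \o phi q s i)).
Qed.

Lemma cell_sum_ge0 F : nonneg F -> nonneg (cells F).
Proof.
move=> pF u; rewrite mulr_ge0 ?invr_ge0 ?(ltW r_gt0)//.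
by apply: sumr_ge0 => i _; exact: pF.
Qed.

Lemma cell_sum_le F G : (forall u, F u u <= G u u) ->
  forall u, cells F u u <= cells G u u.
Proof.
move=> FG u; rewrite ler_wpM2l ?invr_ge0 ?(ltW r_gt0)//.
by apply: ler_sum => i _; exact: FG.
Qed.

Lemma cell_sumD F G u v :
  cells (fun u v => F u v + G u v) u v = cells F u v + cells G u v.
Proof. by rewrite /cell_sum big_split mulrDr. Qed.

Lemma cell_sumZ c F u v :
  cells (fun u v => c * F u v) u v = c * cells F u v.
Proof. by rewrite /cell_sum -mulr_sumr mulrCA. Qed.

Lemma cell_sum_sum (I : Type) (l : seq I) (F : I -> _) u v :
  cells (fun u v => \sum_(i <- l) F i u v) u v =
  \sum_(i <- l) cells (F i) u v.
Proof. by rewrite /cell_sum exchange_big -mulr_sumr. Qed.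

Lemma iter_cell_sum_polar n F : polar F -> polar (iter n cells F).
Proof. by move=> pF; elim: n => // n IH; exact: cell_sum_polar. Qed.

Lemma iter_cell_sum_ge0 n F : nonneg F -> nonneg (iter n cells F).
Proof. by move=> pF; elim: n => // n IH; exact: cell_sum_ge0. Qed.

Lemma iter_cell_sum_le n F G : (forall u, F u u <= G u u) ->
  forall u, iter n cells F u u <= iter n cells G u u.
Proof. by move=> FG; elim: n => // n IH u; exact: cell_sum_le. Qed.

Lemma iter_cell_sumD n F G u v :
  iter n cells (fun u v => F u v + G u v) u v =
  iter n cells F u v + iter n cells G u v.
Proof.
elim: n u v => // n IH u v; rewrite !iterS -cell_sumD.
by congr (_ * _); apply: eq_bigr => i _; exact: IH.
Qed.

Lemma iter_cell_sumZ n c F u v :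
  iter n cells (fun u v => c * F u v) u v = c * iter n cells F u v.
Proof.
elim: n u v => // n IH u v; rewrite !iterS -cell_sumZ.
by congr (_ * _); apply: eq_bigr => i _; exact: IH.
Qed.

Lemma En0 u v : En 0 u v = T u v.
Proof. by rewrite En_decomp big_geq// addr0. Qed.

(** The hybrid is the union of six small copies and of the links. *)
Lemma EnS n u v : En n.+1 u v = cells (En n) u v + links n u v.
Proof.
rewrite En_decomp big_nat_recl//= subn0 addrCA [LHS]addrC; congr (_ + _).
transitivity (cells (fun u v => iter n cells T u v +
  \sum_(0 <= k < n) iter k cells (links (n.-1 - k)) u v) u v); last first.
  by congr (_ * _); apply: eq_bigr => i _; rewrite En_decomp.
rewrite cell_sumD cell_sum_sum; congr (_ + _); apply: eq_bigr => k _.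
by rewrite -subn1 -subnDA add1n.
Qed.

Lemma segment_formE m ij u v : segment_form q s m ij u v =
  dyadic_form (u \o gamma (seg_a q s ij) (seg_b q s ij))
              (v \o gamma (seg_a q s ij) (seg_b q s ij)) m.
Proof.
rewrite /segment_form /incr_form /segment_edges big_map mulr_sumr /dyadic_form.
rewrite /index_iota subn0; apply: eq_bigr => l _ /=.
rewrite /slope /dyadic /=; field.
by rewrite expf_neq0.
Qed.

Lemma segment_form_nd ij u m n : (m <= n)%N ->
  segment_form q s m ij u u <= segment_form q s n ij u u.
Proof.
move=> mn; rewrite !segment_formE; exact: dyadic_energy_nd.
Qed.

Lemma triangle_incr (p : 'I_3 -> plane R) u :
  incr_form (triangle_edges p) u u = tri (u (p 0)) (u (p 1)) (u (p 2)).
Proof.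
by rewrite /incr_form /triangle_edges !big_cons big_nil /= addr0 /tri; ring.
Qed.

Lemma gasket_incrE (p : 'I_3 -> plane R) m u :
  incr_form (gasket_edges p m) u u = \sum_(w : m.-tuple 'I_3)
    incr_form (triangle_edges p) (u \o word_map (fun j => simil 2^-1 (p j)) w)
     (u \o word_map (fun j => simil 2^-1 (p j)) w).
Proof.
rewrite /incr_form /gasket_edges big_flatten big_image /=.
by apply: eq_bigr => w _; rewrite /triangle_edges !big_cons !big_nil.
Qed.

Lemma gasket_incr0 (p : 'I_3 -> plane R) u :
  incr_form (gasket_edges p 0) u u = incr_form (triangle_edges p) u u.
Proof.
rewrite gasket_incrE (bigD1 [tuple])//= big1 ?addr0//.
by case=> [[|? ?] ?] //= /negP[]; apply/eqP/val_inj.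
Qed.

Lemma gasket_incrS (p : 'I_3 -> plane R) m u :
  incr_form (gasket_edges p m.+1) u u = \sum_(i < 3)
    incr_form (gasket_edges p m) (u \o simil 2^-1 (p i)) (u \o simil 2^-1 (p i)).
Proof.
rewrite gasket_incrE sum_tupleS; apply: eq_bigr => i _.
by rewrite gasket_incrE.
Qed.

(** The trace of the first gasket graph: the right-hand side is minimal when each
    midpoint takes 2/5 of both neighbouring vertices and 1/5 of the opposite
    one, and x', y', z' are the deviations from this minimum. *)
Lemma tri_refine (a b c x y z : R) :
  tri a b c <= 5 / 3 * (tri a x y + tri x b z + tri y z c).
Proof.
pose x' := x - (2 * a + 2 * b + c) / 5.
pose y' := y - (2 * a + b + 2 * c) / 5.
pose z' := z - (a + 2 * b + 2 * c) / 5.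
rewrite -subr_ge0.
have -> : 5 / 3 * (tri a x y + tri x b z + tri y z c) - tri a b c =
  5 / 3 * (tri x' y' z' + 2 * (x' ^+ 2 + y' ^+ 2 + z' ^+ 2)).
  by rewrite /tri /x' /y' /z'; field.
by rewrite mulr_ge0// addr_ge0 ?tri_ge0// mulr_ge0// !addr_ge0 ?sqr_ge0.
Qed.

Lemma gasket_form_nd u m n : (m <= n)%N ->
  gasket_form q s m u u <= gasket_form q s n u u.
Proof.
move: m n; apply/nondecreasing_seqP => m; rewrite /gasket_form exprSr -mulrA.
rewrite ler_wpM2l ?exprn_ge0//.
set p := sg_vertex q s; elim: m u => [|m IH] u; last first.
  rewrite gasket_incrS [in leRHS]gasket_incrS mulr_sumr.
  by apply: ler_sum => i _; exact: IH.
rewrite gasket_incr0 gasket_incrS sum_ord3 !gasket_incr0 !triangle_incr /=.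
have simC i j : simil 2^-1 (p i) (p j) = simil 2^-1 (p j) (p i).
  rewrite /simil (_ : 1 - 2^-1 = 2^-1); last by field.
  by rewrite addrC.
rewrite !similxx (simC 1 0) (simC 2 0) (simC 2 1).
exact: tri_refine.
Qed.

Lemma link_form_nd u m n : (m <= n)%N -> links m u u <= links n u u.
Proof.
move=> mn; rewrite lerD ?gasket_form_nd//.
by apply: ler_sum => ij _; exact: segment_form_nd.
Qed.

Lemma link_form_polar m : polar (links m).
Proof.
apply: polarD; last by apply: polarZ; exact: incr_form_polar.
by apply: polar_sum => ij _; apply: polarZ; exact: incr_form_polar.
Qed.

Lemma link_form_ge0 m : nonneg (links m).
Proof.
apply: nonnegD => u.
  apply: sumr_ge0 => ij _; rewrite mulr_ge0 ?exprn_ge0//; exact: incr_form_ge0.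
by rewrite mulr_ge0 ?exprn_ge0//; exact: incr_form_ge0.
Qed.

Lemma triangle_form_ge0 : nonneg T.
Proof.
move=> u; rewrite mulr_ge0 ?invr_ge0 ?(ltW (Rconst_gt0 hr))//.
exact: incr_form_ge0.
Qed.

Lemma triangle_form_polar : polar T.
Proof. by apply: polarZ; exact: incr_form_polar. Qed.

Lemma En_polar n : polar (En n).
Proof.
elim: n => [u v|n IH u v]; first by rewrite !En0; exact: triangle_form_polar.
rewrite !EnS; apply: (polarD (cell_sum_polar IH)); exact: link_form_polar.
Qed.

Lemma En_ge0 n : nonneg (En n).
Proof.
elim: n => [u|n IH u]; first by rewrite En0; exact: triangle_form_ge0.
by rewrite EnS addr_ge0 ?link_form_ge0//; exact: cell_sum_ge0.
Qed.

Lemma triangle_formE u :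
  T u u = (Rconst r)^-1 * tri (u (q 0)) (u (q 1)) (u (q 2)).
Proof. by rewrite /triangle_form triangle_incr. Qed.

Lemma segment_form0 ij u : segment_form q s 0 ij u u =
  (u (seg_a q s ij) - u (seg_b q s ij)) ^+ 2.
Proof.
rewrite /segment_form /segment_edges /= /incr_form big_seq1 /=.
rewrite expr0 mul1r !divr1 /gamma.
by rewrite subr0 subrr !scale1r !scale0r addr0 add0r expr2.
Qed.

Lemma gasket_form0 u : gasket_form q s 0 u u =
  tri (u (sg_vertex q s 0)) (u (sg_vertex q s 1)) (u (sg_vertex q s 2)).
Proof. by rewrite /gasket_form expr0 mul1r gasket_incr0 triangle_incr. Qed.

(** For lam = 1 the energies E_n increase. For lam = 2 the inequality is strict by
    a fixed factor, which is what makes the cell energies vanish. *)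
Lemma triangle_form_trace (lam : R) u : 0 < lam ->
  (1 + (1 - lam^-1) * (3 / Rconst r * loss (Rconst r * r))) * T u u <=
  cells T u u + lam * links 0 u u.
Proof.
move=> lam0.
have R0 := Rconst_gt0 hr.
have rho0 : 0 < Rconst r * r by rewrite mulr_gt0.
rewrite /link_form sum_ordered_pairs !segment_form0 gasket_form0.
rewrite !seg_aE !seg_bE !sg_vertexE /cell_sum sum_ord6 !triangle_formE /=.
rewrite !phi_vertex -!mulrDr (mulrA r^-1) -invfM [r * _]mulrC.
exact: (network_bound _ _ _ _ _ _ _ _ _ _ _ _ _ _ _ _ _ _ R0 rho0 lam0
  (Rconst_fixpoint hr)).
Qed.

End energy_forms.

(** * The limit of the energies *)

Lemma cvgn_sum (R : realType) (I : Type) (l : seq I) (P : pred I)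
    (F : I -> nat -> R) (a : I -> R) :
  (forall i, P i -> F i n @[n --> \oo] --> a i) ->
  \sum_(i <- l | P i) F i n @[n --> \oo] --> \sum_(i <- l | P i) a i.
Proof.
by move=> Fa; apply: cvg_big => //; exact: (@add_continuous R).
Qed.

(** Tannery's theorem for a triangular array that is monotone in the second
    index: the partial sums are caught between the convolution and its limit. *)
Lemma cvg_nondecreasing_convolution (R : realType) (d : nat -> nat -> R)
    (dinf : nat -> R) (S : R) :
  (forall k, {homo d k : m n / (m <= n)%N >-> m <= n}) ->
  (forall k m, 0 <= d k m) ->
  (forall k, d k m @[m --> \oo] --> dinf k) ->
  \sum_(0 <= k < n) d k (n.-1 - k)%N @[n --> \oo] --> S ->
  series dinf n @[n --> \oo] --> S.
Proof.
move=> dnd d0 dd conv.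
have dle k m : d k m <= dinf k.
  rewrite -(cvg_lim _ (dd k))//; apply: nondecreasing_cvgn_le => //.
  by apply/cvg_ex; exists (dinf k).
have dinf0 k : 0 <= dinf k by apply: le_trans (dle k 0%N).
have up N : series dinf N <= S.
  have c : \sum_(0 <= k < N) d k (n.-1 - k)%N @[n --> \oo] --> series dinf N.
    apply: cvgn_sum => k _.
    rewrite -(cvg_shiftn k.+1); apply: cvg_trans (dd k); apply: near_eq_cvg.
    by exists 0%N => // n _ /=; rewrite addnS /= addnK.
  apply: (ler_cvg_to c conv); exists N => // n /= Nn.
  rewrite [leRHS](big_cat_nat (n := N))//= lerDl sumr_ge0//.
apply: (squeeze_cvgr _ conv (cvg_cst S)).
apply: nearW => n; rewrite up andbT.
by apply: ler_sum => k _; exact: dle.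
Qed.

Lemma continuous_within_comp (T U W : topologicalType) (A : set T) (B : set U)
    (g : T -> U) (f : U -> W) :
  continuous g -> (forall x, A x -> B (g x)) ->
  {within B, continuous f} -> {within A, continuous (f \o g)}.
Proof.
move=> cg AB /subspace_continuousP cf; apply/subspace_continuousP => x Ax.
move=> V /(cf _ (AB _ Ax)) /(cg x) h.
suff : nbhs x (fun y => A y -> V (f (g y))) by [].
have {}h : nbhs x (fun y => B (g y) -> V (f (g y))) := h.
by apply: filterS h => y hy Ay; apply: hy; exact: AB.
Qed.

Lemma continuous_simil (R : realType) (c : R) (a : plane R) :
  continuous (simil c a).
Proof.
move=> x; apply: (@cvgD _ _ _ (nbhs x) _ (fun y : plane R => c *: y)
  (fun=> (1 - c) *: a)); last exact: cvg_cst.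
exact: (@cvgZ R _ _ (nbhs x) _ (fun=> c) id c x (cvg_cst c) cvg_id).
Qed.

Lemma continuous_gamma (R : realType) (a b : plane R) : continuous (gamma a b).
Proof.
move=> t; apply: (@cvgD _ _ _ (nbhs t) _ (fun y : R => (1 - y) *: a)
  (fun y : R => y *: b)).
  have h : 1 - y @[y --> t] --> 1 - t.
    by apply: cvgB; [exact: cvg_cst|exact: cvg_id].
  exact: (@cvgZ R _ _ (nbhs t) _ _ (fun=> a) _ a h (cvg_cst a)).
exact: (@cvgZ R _ _ (nbhs t) _ id (fun=> b) t b cvg_id (cvg_cst b)).
Qed.

Section energy_limit.
Variables (R : realType) (q : 'I_3 -> plane R) (s r : R) (H : set (plane R)).
Hypothesis hr : 0 < r < 7 / 15.
Hypothesis H_cell : forall i x, H x -> H (phi q s i x).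
Hypothesis H_segment : forall ij t, ij.1 != ij.2 -> 0 <= t <= 1 ->
  H (gamma (seg_a q s ij) (seg_b q s ij) t).
Implicit Types (u v : plane R -> R).
Notation cells := (cell_sum q s r).
Notation links := (link_form q s).
Notation T := (triangle_form q r).
Notation En := (En q s r).
Notation domE := (domE q s r H).

Let r_gt0 : 0 < r. Proof. by case/andP: hr. Qed.

Definition link_energy u v : R :=
  \sum_(ij : 'I_3 * 'I_3 | ij.1 != ij.2)
     energy_segment (seg_a q s ij) (seg_b q s ij) u v
  + energy_gasket (sg_vertex q s) u v.

Lemma triangle_form_le u : T u u <= cells T u u + links 0 u u.
Proof.
have := triangle_form_trace q s hr u ltr01.
by rewrite invr1 subrr mul0r addr0 !mul1r.
Qed.

Lemma En_nd u : {homo (fun n => En n u u) : m n / (m <= n)%N >-> m <= n}.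
Proof.
apply/nondecreasing_seqP => n; elim: n u => [|n IH] u.
  rewrite EnS En0; apply: le_trans (triangle_form_le u) _.
  rewrite lerD2r; apply: (cell_sum_le q s hr) => w.
  by rewrite En0.
rewrite [leRHS]EnS EnS lerD ?link_form_nd//.
exact: (cell_sum_le q s hr (F := En n) (G := En n.+1)).
Qed.

Lemma domE_bounded u B : {within H, continuous u} ->
  (forall n, En n u u <= B) -> domE u.
Proof.
move=> cu uB; split => //; apply: nondecreasing_is_cvgn; first exact: En_nd.
by exists B => _ [n _ <-].
Qed.

Lemma En_le_E u n : domE u -> En n u u <= E q s r u u.
Proof.
by move=> [_ cu]; apply: (nondecreasing_cvgn_le (@En_nd u)).
Qed.

Lemma E_le u B : domE u -> (forall n, En n u u <= B) -> E q s r u u <= B.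
Proof.
by move=> [_ cu] uB; apply: limr_le => //; apply: nearW.
Qed.

(** Inside one cell there is at most r times the total energy. *)
Lemma domE_cell u i : domE u -> domE (u \o phi q s i).
Proof.
move=> du; apply: (@domE_bounded _ (r * E q s r u u)).
  apply: continuous_within_comp du.1; last exact: H_cell.
  exact: continuous_simil.
move=> n; have := En_le_E n.+1 du; rewrite EnS.
have := link_form_ge0 q s n u; set l := links n u u => l0.
rewrite /cell_sum (bigD1 i)//=; set S := \sum_(j < 6 | _) _.
have S0 : 0 <= S by apply: sumr_ge0 => j _; exact: (En_ge0 q s hr).
move=> h; rewrite -ler_pdivrMl//; apply: le_trans h.
by rewrite mulrDr -addrA lerDl addr_ge0// mulr_ge0// invr_ge0 ltW.
Qed.

Lemma domE_D u v : domE u -> domE v -> domE (u \+ v).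
Proof.
move=> du dv; apply: (@domE_bounded _ (2 * E q s r u u + 2 * E q s r v v)).
  by move=> x; apply: cvgD; [exact: du.1|exact: dv.1].
move=> n; have [h _] := polar_le2 u v (En_polar q s r n) (En_ge0 q s hr n).
by apply: le_trans h _; rewrite lerD// ler_pM2l// En_le_E.
Qed.

Lemma domE_B u v : domE u -> domE v -> domE (u \- v).
Proof.
move=> du dv; apply: (@domE_bounded _ (2 * E q s r u u + 2 * E q s r v v)).
  by move=> x; apply: cvgB; [exact: du.1|exact: dv.1].
move=> n; have [_ h] := polar_le2 u v (En_polar q s r n) (En_ge0 q s hr n).
by apply: le_trans h _; rewrite lerD// ler_pM2l// En_le_E.
Qed.

Lemma link_form_le_E u m : domE u -> links m u u <= E q s r u u.
Proof.
move=> du; have := En_le_E m.+1 du; rewrite EnS; apply: le_trans.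
by rewrite lerDr; apply: (cell_sum_ge0 q s hr); exact: En_ge0.
Qed.

Lemma segment_form_ge0 m ij : nonneg (segment_form q s m ij).
Proof. by move=> u; rewrite mulr_ge0 ?exprn_ge0// incr_form_ge0. Qed.

Lemma gasket_form_ge0 m : nonneg (gasket_form q s m).
Proof. by move=> u; rewrite mulr_ge0 ?exprn_ge0// incr_form_ge0. Qed.

Lemma is_cvg_segment_form u ij : domE u -> ij.1 != ij.2 ->
  cvgn (fun m => segment_form q s m ij u u).
Proof.
move=> du ij0; apply: nondecreasing_is_cvgn => [m n|].
  exact: segment_form_nd.
exists (E q s r u u) => _ [m _ <-]; apply: le_trans (link_form_le_E m du).
rewrite /link_form (bigD1 ij)//= -addrA lerDl addr_ge0 ?gasket_form_ge0//.
by apply: sumr_ge0 => kl _; exact: segment_form_ge0.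
Qed.

Lemma is_cvg_gasket_form u : domE u -> cvgn (fun m => gasket_form q s m u u).
Proof.
move=> du; apply: nondecreasing_is_cvgn => [m n|].
  exact: gasket_form_nd.
exists (E q s r u u) => _ [m _ <-]; apply: le_trans (link_form_le_E m du).
by rewrite lerDr; apply: sumr_ge0 => kl _; exact: segment_form_ge0.
Qed.

Lemma polar_cvg (F : nat -> (plane R -> R) -> (plane R -> R) -> R) u v a b c :
  (forall n, polar (F n)) ->
  F n u u @[n --> \oo] --> a -> F n v v @[n --> \oo] --> b ->
  F n (u \+ v) (u \+ v) @[n --> \oo] --> c ->
  F n u v @[n --> \oo] --> 2^-1 * (c - a - b).
Proof.
move=> pF ua vb wc.
have -> : (fun n => F n u v) = fun n => 2^-1 *
    (F n (u \+ v) (u \+ v) - F n u u - F n v v).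
  by apply/funext => n; have [-> _] := pF n u v; field.
by apply: cvgM; [exact: cvg_cst|apply: cvgB => //; apply: cvgB].
Qed.

(** All pieces are bounded by the energy, and increase with the level when
    u = v. *)
Lemma cvg_link_form u v : domE u -> domE v ->
  links m u v @[m --> \oo] --> link_energy u v.
Proof.
move=> du dv; apply: cvgD; last first.
  suff : cvgn (fun m => gasket_form q s m u v) by [].
  have /cvg_ex[a ua] := is_cvg_gasket_form du.
  have /cvg_ex[b vb] := is_cvg_gasket_form dv.
  have /cvg_ex[c wc] := is_cvg_gasket_form (domE_D du dv).
  apply/cvg_ex; exists (2^-1 * (c - a - b)).
  by apply: (polar_cvg _ ua vb wc) => m; apply: polarZ; exact: incr_form_polar.
apply: cvgn_sum => ij ij0.
have -> : (fun m => segment_form q s m ij u v) = dyadic_form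
    (u \o gamma (seg_a q s ij) (seg_b q s ij))
    (v \o gamma (seg_a q s ij) (seg_b q s ij)).
  by apply/funext => m; rewrite segment_formE.
have cont w : domE w -> {within `[0, 1], continuous
    (w \o gamma (seg_a q s ij) (seg_b q s ij))}.
  move=> [cw _]; apply: continuous_within_comp cw.
    exact: continuous_gamma.
  by move=> t; rewrite /= in_itv /= => t01; exact: H_segment.
have cvgd w : domE w -> cvgn (dyadic_energy
    (w \o gamma (seg_a q s ij) (seg_b q s ij))).
  move=> dw; have := is_cvg_segment_form dw ij0.
  by under eq_fun do rewrite segment_formE.
by apply: cvg_dyadic_form; [exact: cont|exact: cont|exact: cvgd|exact: cvgd].
Qed.

Lemma cvg_iter_link_form k u v : domE u -> domE v ->
  iter k cells (links m) u v @[m --> \oo] --> iter k cells link_energy u v.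
Proof.
elim: k u v => [|k IH] u v du dv; first exact: cvg_link_form.
rewrite /= /cell_sum; apply: cvgM; first exact: cvg_cst.
by apply: cvgn_sum => i _; apply: IH; exact: domE_cell.
Qed.

Lemma Etilde_iter u v :
  Etilde q s r u v = limn (series (fun k => iter k cells link_energy u v)).
Proof.
congr (limn (series _)); apply/funext => k; rewrite iter_cell_sum mulr_sumr.
apply: eq_bigr => a _; rewrite /link_energy mulrDr mulr_sumr.
by congr (_ + _); apply: eq_bigr.
Qed.

Lemma iter_triangle_form_trace u :
  exists2 eta : R, 0 < eta & forall n,
    (1 + eta) * iter n cells T u u <=
    iter n.+1 cells T u u + 2 * iter n cells (links 0) u u.
Proof.
have R0 := Rconst_gt0 hr.
have rho0 : 0 < Rconst r * r by rewrite mulr_gt0.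
exists ((1 - 2^-1) * (3 / Rconst r * loss (Rconst r * r))).
  by rewrite mulr_gt0//; [lra|rewrite mulr_gt0 ?loss_gt0// divr_gt0].
move=> n; rewrite -iter_cell_sumZ iterSr -[in leRHS]iter_cell_sumZ.
rewrite -iter_cell_sumD; apply: (iter_cell_sum_le q s hr) => w.
exact: triangle_form_trace.
Qed.

Definition links_up_to (n : nat) u v : R :=
  \sum_(0 <= k < n) iter k cells (links (n.-1 - k)) u v.

Lemma links_up_toS n u :
  links_up_to n u u + iter n cells (links 0) u u <= links_up_to n.+1 u u.
Proof.
rewrite /links_up_to big_nat_recr//= subnn lerD2r.
apply: ler_sum_nat => k /andP[_ kn]; apply: (iter_cell_sum_le q s hr) => w.
by apply: link_form_nd; rewrite leq_sub2r// leq_pred.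
Qed.

Lemma links_up_to_nd u :
  {homo (fun n => links_up_to n u u) : m n / (m <= n)%N >-> m <= n}.
Proof.
apply/nondecreasing_seqP => n; apply: le_trans (links_up_toS n u).
by rewrite lerDl; apply: (iter_cell_sum_ge0 q s hr); exact: link_form_ge0.
Qed.

(** In the limit, the two sides of [iter_triangle_form_trace] differ only by the
    factor 1 + eta, since the links of level n contribute the increment of a
    convergent sequence. *)
Lemma cell_energy_vanishes u : domE u ->
  iter n cells T u u @[n --> \oo] --> 0 /\
  links_up_to n u u @[n --> \oo] --> E q s r u u.
Proof.
move=> du.
have EnE n : En n u u = iter n cells T u u + links_up_to n u u.
  exact: En_decomp.
have T0 n : 0 <= iter n cells T u u.
  by apply: (iter_cell_sum_ge0 q s hr); exact: triangle_form_ge0.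
have /cvg_ex[S cS] : cvgn (fun n => links_up_to n u u).
  apply: nondecreasing_is_cvgn; first exact: links_up_to_nd.
  exists (E q s r u u) => _ [n _ <-]; apply: le_trans (En_le_E n du).
  by rewrite EnE lerDr.
have cE : En n u u @[n --> \oo] --> E q s r u u by exact: du.2.
have cT : iter n cells T u u @[n --> \oo] --> E q s r u u - S.
  have -> : (fun n => iter n cells T u u) = fun n => En n u u - links_up_to n u u.
    by apply/funext => n; rewrite EnE addrK.
  exact: cvgB.
have cL : iter n cells (links 0) u u @[n --> \oo] --> 0.
  apply: (@squeeze_cvgr _ _ _ _ (fun=> 0)
    (fun n => links_up_to n.+1 u u - links_up_to n u u)); last 2 first.
  - exact: cvg_cst.
  - rewrite -(subrr S); apply: cvgB => //.
    by have := cS; rewrite -cvg_shiftS.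
  apply: nearW => n; rewrite lerBrDl links_up_toS andbT.
  by apply: (iter_cell_sum_ge0 q s hr); exact: link_form_ge0.
have [eta eta0 le_eta] := iter_triangle_form_trace u.
have lim0 : E q s r u u - S = 0.
  have ge0 : 0 <= E q s r u u - S by apply: (ler_cvg_to (cvg_cst 0) cT); exact: nearW.
  have c1 : (1 + eta) * iter n cells T u u @[n --> \oo] -->
      (1 + eta) * (E q s r u u - S) by apply: cvgM => //; exact: cvg_cst.
  have c2 : iter n.+1 cells T u u + 2 * iter n cells (links 0) u u @[n --> \oo]
      --> (E q s r u u - S) + 2 * 0.
    apply: cvgD; first by have := cT; rewrite -cvg_shiftS.
    by apply: cvgM => //; exact: cvg_cst.
  have := ler_cvg_to c1 c2 (nearW _ le_eta).
  rewrite mulr0 addr0 mulrDl mul1r gerDl pmulr_rle0// => le0.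
  by apply/eqP; rewrite eq_le le0 ge0.
split; first by rewrite -lim0.
by have -> : E q s r u u = S by apply/eqP; rewrite -subr_eq0 lim0.
Qed.

Lemma E_series u : domE u ->
  series (fun k => iter k cells link_energy u u) n @[n --> \oo] --> E q s r u u.
Proof.
move=> du; have [_ cS] := cell_energy_vanishes du.
apply: (cvg_nondecreasing_convolution (d := fun k m => iter k cells (links m) u u)).
- move=> k m n mn; apply: (iter_cell_sum_le q s hr) => w; exact: link_form_nd.
- by move=> k m; apply: (iter_cell_sum_ge0 q s hr); exact: link_form_ge0.
- by move=> k; exact: cvg_iter_link_form.
- exact: cS.
Qed.

Lemma E_Etilde u v : domE u -> domE v -> E q s r u v = Etilde q s r u v.
Proof.
move=> du dv; have dw := domE_D du dv.
have cE : En n u v @[n --> \oo] --> 2^-1 *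
    (E q s r (u \+ v) (u \+ v) - E q s r u u - E q s r v v).
  exact: (polar_cvg (En_polar q s r) du.2 dv.2 dw.2).
rewrite [LHS](cvg_lim _ cE)// Etilde_iter; apply/esym/cvg_lim => //.
have -> : series (fun k => iter k cells link_energy u v) =
    fun n => 2^-1 * (series (fun k => iter k cells link_energy (u \+ v) (u \+ v)) n
     - series (fun k => iter k cells link_energy u u) n
     - series (fun k => iter k cells link_energy v v) n).
  apply/funext => n; rewrite /series /= -!sumrB mulr_sumr.
  apply: eq_bigr => k _; apply: (cvg_unique _ (cvg_iter_link_form du dv)) => //.
  have pF m : polar (iter k cells (links m)).
    by apply: iter_cell_sum_polar; exact: link_form_polar.
  exact: (polar_cvg pF (cvg_iter_link_form (k := k) du du)
    (cvg_iter_link_form (k := k) dv dv) (cvg_iter_link_form (k := k) dw dw)).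
apply: cvgM; first exact: cvg_cst.
by apply: cvgB; [apply: cvgB|]; exact: E_series.
Qed.

End energy_limit.

(** * Barycentric coordinates *)

Lemma ord3_ind (P : 'I_3 -> Prop) : P 0 -> P 1 -> P 2 -> forall i, P i.
Proof.
move=> P0 P1 P2 [[|[|[|?]]] Hi]//.
- by rewrite (_ : Ordinal Hi = 0)//; exact: val_inj.
- by rewrite (_ : Ordinal Hi = 1)//; exact: val_inj.
- by rewrite (_ : Ordinal Hi = 2)//; exact: val_inj.
Qed.

Lemma ord6_ind (P : 'I_6 -> Prop) :
  P 0 -> P 1 -> P 2 -> P 3 -> P 4 -> P 5 -> forall i, P i.
Proof.
move=> P0 P1 P2 P3 P4 P5 [[|[|[|[|[|[|?]]]]]] Hi]//.
- by rewrite (_ : Ordinal Hi = 0)//; exact: val_inj.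
- by rewrite (_ : Ordinal Hi = 1)//; exact: val_inj.
- by rewrite (_ : Ordinal Hi = 2)//; exact: val_inj.
- by rewrite (_ : Ordinal Hi = 3)//; exact: val_inj.
- by rewrite (_ : Ordinal Hi = 4)//; exact: val_inj.
- by rewrite (_ : Ordinal Hi = 5)//; exact: val_inj.
Qed.

Section barycentric_coordinates.
Variables (R : realType) (q : 'I_3 -> plane R).
Implicit Types (x y a : plane R).

Definition cross x y : R := x 0 0 * y 0 1 - x 0 1 * y 0 0.

(** Cramer's rule in the basis q 1 - q 0, q 2 - q 0. *)
Definition bary (k : 'I_3) x : R :=
  let l1 := cross (x - q 0) (q 2 - q 0) / cross (q 1 - q 0) (q 2 - q 0) in
  let l2 := cross (q 1 - q 0) (x - q 0) / cross (q 1 - q 0) (q 2 - q 0) in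
  if k == 0 then 1 - l1 - l2 else if k == 1 then l1 else l2.

Lemma bary_sum x : bary 0 x + bary 1 x + bary 2 x = 1.
Proof. by rewrite /bary /=; ring. Qed.

Lemma bary_simil k c a x :
  bary k (simil c a x) = c * bary k x + (1 - c) * bary k a.
Proof.
rewrite /bary /cross /simil !mxE; case: ifP => _; last case: ifP => _; ring.
Qed.

Lemma bary_continuous k : continuous (bary k).
Proof.
have aff (a b c : R) : continuous (fun x : plane R => a * x 0 0 + b * x 0 1 + c).
  have cc (e : R) (i : 'I_2) (x : plane R) :
      e * y 0 i @[y --> x] --> e * x 0 i.
    have hc : y 0 i @[y --> x] --> x 0 i by exact: coord_continuous.
    by apply: (@cvgM _ _ (nbhs x) _ (fun=> e) (fun y : plane R => y 0 i));
      [exact: cvg_cst|exact: hc].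
  move=> x; apply: (@cvgD _ _ _ (nbhs x) _
    (fun y : plane R => a * y 0 0 + b * y 0 1) (fun=> c)); last exact: cvg_cst.
  by apply: (@cvgD _ _ _ (nbhs x) _ (fun y : plane R => a * y 0 0)
    (fun y : plane R => b * y 0 1)); [exact: cc|exact: cc].
pose d := cross (q 1 - q 0) (q 2 - q 0).
have E (a b c : R) : (forall x, bary k x = a * x 0 0 + b * x 0 1 + c) ->
    continuous (bary k).
  by move=> E; rewrite (_ : bary k = fun x => a * x 0 0 + b * x 0 1 + c);
    [exact: aff|exact/funext].
have X (x y : plane R) i : (x - y) 0 i = x 0 i - y 0 i by rewrite !mxE.
elim/ord3_ind: k E => E.
- apply: (E
    ((q 1 0 1 - q 2 0 1) / d)
    ((q 2 0 0 - q 1 0 0) / d)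
    (1 + (q 0 0 0 * (q 2 0 1 - q 0 0 1) - q 0 0 1 * (q 2 0 0 - q 0 0 0)) / d
       + (q 0 0 1 * (q 1 0 0 - q 0 0 0) - q 0 0 0 * (q 1 0 1 - q 0 0 1)) / d)) => x.
  by rewrite /bary /= /d /cross !X; ring.
- apply: (E ((q 2 0 1 - q 0 0 1) / d) ((q 0 0 0 - q 2 0 0) / d)
    ((q 0 0 1 * (q 2 0 0 - q 0 0 0) - q 0 0 0 * (q 2 0 1 - q 0 0 1)) / d)) => x.
  by rewrite /bary /= /d /cross !X; ring.
- apply: (E ((q 0 0 1 - q 1 0 1) / d) ((q 1 0 0 - q 0 0 0) / d)
    ((q 0 0 0 * (q 1 0 1 - q 0 0 1) - q 0 0 1 * (q 1 0 0 - q 0 0 0)) / d)) => x.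
  by rewrite /bary /= /d /cross !X; ring.
Qed.

Hypothesis hq : unit_equilateral q.

(** The Gram determinant of two unit vectors at unit distance is 3/4. *)
Lemma cross_neq0 : cross (q 1 - q 0) (q 2 - q 0) != 0.
Proof.
have d (i j : 'I_3) : i != j ->
    (q i 0 0 - q j 0 0) ^+ 2 + (q i 0 1 - q j 0 1) ^+ 2 = 1.
  move=> ij; have := hq ij; rewrite /eucl_dist big_ord_recl big_ord1.
  have -> : lift ord0 ord0 = 1 :> 'I_2 by exact: val_inj.
  have -> : ord0 = 0 :> 'I_2 by exact: val_inj.
  move=> /(congr1 (fun z => z ^+ 2)); rewrite sqr_sqrtr ?expr1n//.
  by rewrite addr_ge0 ?sqr_ge0.
have := d 1 0 isT; have := d 2 0 isT; have := d 1 2 isT.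
rewrite /cross !mxE.
set a := q 1 0 0; set b := q 1 0 1; set c := q 2 0 0; set e := q 2 0 1.
set o := q 0 0 0; set p := q 0 0 1.
move=> h3 h2 h1; apply/eqP => h.
have dot : (a - o) * (c - o) + (b - p) * (e - p) = 2^-1.
  have : 2 * ((a - o) * (c - o) + (b - p) * (e - p)) =
    ((a - o) ^+ 2 + (b - p) ^+ 2) + ((c - o) ^+ 2 + (e - p) ^+ 2)
    - ((a - c) ^+ 2 + (b - e) ^+ 2) by ring.
  by rewrite h1 h2 h3; lra.
have : ((a - o) ^+ 2 + (b - p) ^+ 2) * ((c - o) ^+ 2 + (e - p) ^+ 2) =
   ((a - o) * (e - p) - (b - p) * (c - o)) ^+ 2 +
   ((a - o) * (c - o) + (b - p) * (e - p)) ^+ 2 by ring.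
rewrite h1 h2 dot h; lra.
Qed.

Lemma bary_vertex k j : bary k (q j) = (k == j)%:R.
Proof.
have n0 := cross_neq0; rewrite /bary; set d := cross (q 1 - q 0) _ in n0 *.
have c0 (x : plane R) : cross 0 x = 0 by rewrite /cross !mxE; ring.
have c0' (x : plane R) : cross x 0 = 0 by rewrite /cross !mxE; ring.
have cxx (x : plane R) : cross x x = 0 by rewrite /cross; ring.
move: j k; apply: ord3_ind; apply: ord3_ind => /=;
  rewrite ?subrr ?c0 ?c0' ?cxx -?/d ?mul0r ?divff ?subr0 ?subrr//.
Qed.

Lemma bary_inj x y : (forall k, bary k x = bary k y) -> x = y.
Proof.
move=> xy; have n0 := cross_neq0.
have := xy 1; have := xy 2; rewrite /bary /=.
move=> /(mulIf (invr_neq0 n0)) + /(mulIf (invr_neq0 n0)).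
move: n0; rewrite /cross.
have X (a b : plane R) i : (a - b) 0 i = a 0 i - b 0 i by rewrite !mxE.
rewrite !X.
set a := q 1 0 0; set b := q 1 0 1; set c := q 2 0 0; set e := q 2 0 1.
set o := q 0 0 0; set p := q 0 0 1.
move=> n0 h2 h1.
have e0 : x 0 0 = y 0 0.
  apply: (mulIf n0).
  have -> : x 0 0 * ((a - o) * (e - p) - (b - p) * (c - o)) =
    (a - o) * ((x 0 0 - o) * (e - p) - (x 0 1 - p) * (c - o))
    + (c - o) * ((a - o) * (x 0 1 - p) - (b - p) * (x 0 0 - o))
    + o * ((a - o) * (e - p) - (b - p) * (c - o)) by ring.
  by rewrite h1 h2; ring.
have e1 : x 0 1 = y 0 1.
  apply: (mulIf n0).
  have -> : x 0 1 * ((a - o) * (e - p) - (b - p) * (c - o)) =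
    (b - p) * ((x 0 0 - o) * (e - p) - (x 0 1 - p) * (c - o))
    + (e - p) * ((a - o) * (x 0 1 - p) - (b - p) * (x 0 0 - o))
    + p * ((a - o) * (e - p) - (b - p) * (c - o)) by ring.
  by rewrite h1 h2; ring.
apply/rowP; case=> [[|[|?]] Hi]//.
- by rewrite (_ : Ordinal Hi = 0)//; exact: val_inj.
- by rewrite (_ : Ordinal Hi = 1)//; exact: val_inj.
Qed.

End barycentric_coordinates.

(** * Position of the cells and of the links *)

Section cells_and_links.
Variables (R : realType) (q : 'I_3 -> plane R) (s : R).
Hypothesis hq : unit_equilateral q.
Hypothesis hs : 0 < s < 1 / 3.
Notation lam := (bary q).
Implicit Types x y : plane R.

Let s_gt0 : 0 < s. Proof. by case/andP: hs. Qed.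

Definition affine (f : plane R -> R) : Prop :=
  forall c a x, f (simil c a x) = c * f x + (1 - c) * f a.

Lemma bary_affine k : affine (lam k).
Proof. by move=> c a x; rewrite bary_simil. Qed.

Lemma affine_midpoint f x y : affine f -> f (midpoint x y) = 2^-1 * (f x + f y).
Proof.
move=> af; have -> : midpoint x y = simil 2^-1 y x.
  by rewrite /midpoint /simil scalerDr (_ : 1 - 2^-1 = 2^-1)//; field.
by rewrite af; field.
Qed.

Lemma affine_gamma f x y t : affine f ->
  f (gamma x y t) = (1 - t) * f x + t * f y.
Proof.
move=> af; have -> : gamma x y t = simil (1 - t) y x.
  by rewrite /gamma /simil subKr.
by rewrite af subKr.
Qed.

Definition bary_center (k : 'I_3) (i : 'I_6) : R :=
  lam k (center q i).

(** The coordinates locate every cell: the i-th similitude maps the triangle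
    onto the points whose coordinate k is at least (1 - s) times the entry (k, i),
    for each k. *)
Lemma bary_centerE :
  ((bary_center 0 0 = 1) * (bary_center 1 0 = 0) * (bary_center 2 0 = 0)) *
  ((bary_center 0 1 = 0) * (bary_center 1 1 = 1) * (bary_center 2 1 = 0)) *
  ((bary_center 0 2 = 0) * (bary_center 1 2 = 0) * (bary_center 2 2 = 1)) *
  ((bary_center 0 3 = 2^-1) * (bary_center 1 3 = 2^-1) * (bary_center 2 3 = 0)) *
  ((bary_center 0 4 = 2^-1) * (bary_center 1 4 = 0) * (bary_center 2 4 = 2^-1)) *
  ((bary_center 0 5 = 0) * (bary_center 1 5 = 2^-1) * (bary_center 2 5 = 2^-1)).
Proof.
rewrite /bary_center !centerE.
rewrite !(affine_midpoint _ _ (@bary_affine _)) !(bary_vertex hq) /=.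
by rewrite ?addr0 ?add0r ?mulr1 ?mulr0.
Qed.

Lemma bary_phi k i x :
  lam k (phi q s i x) = s * lam k x + (1 - s) * bary_center k i.
Proof. exact: bary_affine. Qed.

Definition in_triangle x : Prop := forall k, 0 <= lam k x.

Definition in_cell (i : 'I_6) x : bool :=
  [forall k, (1 - s) * bary_center k i <= lam k x].

Definition phi_inv (i : 'I_6) x : plane R :=
  simil s^-1 (center q i) x.

Lemma phiK i : cancel (phi q s i) (phi_inv i).
Proof.
move=> x; rewrite /phi_inv /phi /simil scalerDr !scalerA mulVf ?gt_eqF//.
have s0 : s != 0 by rewrite gt_eqF.
rewrite scale1r -addrA -scalerDl [X in X *: _](_ : _ = 0) ?scale0r ?addr0//.
by field.
Qed.

Lemma in_cell_phi i x : in_triangle x -> in_cell i (phi q s i x).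
Proof.
move=> tx; apply/forallP => k; rewrite bary_phi lerDr.
by rewrite mulr_ge0 ?tx// ltW.
Qed.

Lemma in_cell_disjoint i j x : in_cell i x -> in_cell j x -> i = j.
Proof.
move=> /forallP hi /forallP hj; have := bary_sum q x.
have := hi 0; have := hi 1; have := hi 2.
have := hj 0; have := hj 1; have := hj 2; case/andP: hs => {hi hj} h0 h1.
move: (lam 0 x) (lam 1 x) (lam 2 x) => a b c.
by elim/ord6_ind: i; elim/ord6_ind: j => //; rewrite !bary_centerE => *;
  exfalso; lra.
Qed.

Lemma vertex_in_triangle k : in_triangle (q k).
Proof. by move=> j; rewrite (bary_vertex hq) ler0n. Qed.

Lemma bary_center_ge0 k i : 0 <= bary_center k i.
Proof.
by elim/ord6_ind: i; elim/ord3_ind: k; rewrite !bary_centerE// invr_ge0.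
Qed.

Lemma phi_in_triangle i x : in_triangle x -> in_triangle (phi q s i x).
Proof.
move=> tx k; rewrite bary_phi addr_ge0 ?mulr_ge0 ?tx ?bary_center_ge0//.
  by rewrite ltW.
by case/andP: hs => _; lra.
Qed.

(** This contains the gasket of J and its discrete approximations, and separates
    them from the three corner cells. *)
Definition in_core x : Prop := forall k, lam k x <= (1 - s) / 2.

Definition on_link x : Prop := in_core x \/
  exists ij t, [/\ ij.1 != ij.2, 0 <= t <= 1 &
    x = gamma (seg_a q s ij) (seg_b q s ij) t].

Lemma core_cell_corner x c : in_core x -> in_cell c x ->
  exists k, x = phi q s c (q k).
Proof.
move=> cx /forallP hc; have := bary_sum q x.
have := hc 0; have := hc 1; have := hc 2.
have := cx 0; have := cx 1; have := cx 2; case/andP: (hs) => {hc cx} h0 h1.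
(* Each middle cell touches the gasket at the corner opposite to its side; for
   the corner cells c < 3 the hypotheses are contradictory. *)
pose k : 'I_3 := if c == 3 then 2 else if c == 4 then 1 else 0.
suff E : forall j, lam 0 x <= (1 - s) / 2 -> lam 1 x <= (1 - s) / 2 ->
   lam 2 x <= (1 - s) / 2 ->
   (1 - s) * bary_center 0 c <= lam 0 x ->
   (1 - s) * bary_center 1 c <= lam 1 x ->
   (1 - s) * bary_center 2 c <= lam 2 x ->
   lam 0 x + lam 1 x + lam 2 x = 1 -> lam j x = lam j (phi q s c (q k)).
  by move=> *; exists k; apply: (bary_inj hq) => j; apply: E.
move=> j; rewrite bary_phi (bary_vertex hq) {}/k.
by elim/ord6_ind: c; elim/ord3_ind: j; rewrite !bary_centerE /= => *; lra.
Qed.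

Lemma vertex_cell_corner c i k : in_cell c (phi q s i (q k)) ->
  exists j, phi q s i (q k) = phi q s c (q j).
Proof.
move=> h; exists k; congr (phi q s _ _).
exact: in_cell_disjoint (in_cell_phi i (@vertex_in_triangle k)) h.
Qed.

(** The parameters t = 0 and t = 1 give corners of the two cells that the segment
    joins. For the others, both t (1 - 3 s) and (1 - t) (1 - 3 s) are positive, and
    one coordinate is too small for each of the six cells. *)
Lemma segment_cell_corner ij t c : ij.1 != ij.2 -> 0 <= t <= 1 ->
  in_cell c (gamma (seg_a q s ij) (seg_b q s ij) t) ->
  exists k, gamma (seg_a q s ij) (seg_b q s ij) t = phi q s c (q k).
Proof.
move=> ij0 /andP[t0 t1].
have [->|tn0] := eqVneq t 0.
  rewrite /gamma subr0 scale1r scale0r addr0; move: ij0.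
  by case: ij => i j; elim/ord3_ind: i; elim/ord3_ind: j => //= _;
    rewrite !seg_aE; exact: vertex_cell_corner.
have [->|tn1] := eqVneq t 1.
  rewrite /gamma subrr scale1r scale0r add0r; move: ij0.
  by case: ij => i j; elim/ord3_ind: i; elim/ord3_ind: j => //= _;
    rewrite !seg_bE; exact: vertex_cell_corner.
have s3 : 0 < 1 - 3 * s by case/andP: hs; lra.
have p0 : 0 < t * (1 - 3 * s) by rewrite mulr_gt0// lt_def tn0.
have p1 : 0 < (1 - t) * (1 - 3 * s).
  by rewrite mulr_gt0// subr_gt0 lt_def eq_sym tn1.
move=> /forallP hc; exfalso; have := hc 0; have := hc 1; have := hc 2.
rewrite !(affine_gamma _ _ _ (@bary_affine _)).
clear hc; move: ij0; case: ij => i j.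
elim/ord3_ind: i; elim/ord3_ind: j => //= _;
  rewrite !seg_aE !seg_bE !bary_phi !(bary_vertex hq) /= !bary_centerE;
  elim/ord6_ind: c; rewrite !bary_centerE => *; case/andP: (hs) => h0 h1; lra.
Qed.

(** Here s < 1/3 is used: a link touches the cells at corners only, which is what
    allows gluing. *)
Lemma link_cell_corner x c : on_link x -> in_cell c x ->
  exists k, x = phi q s c (q k).
Proof.
move=> [cx|[ij [t [ij0 t01 ->]]]]; first exact: core_cell_corner.
exact: segment_cell_corner.
Qed.

Lemma sg_vertex_in_core : forall i k, lam k (sg_vertex q s i) <= (1 - s) / 2.
Proof.
case/andP: hs => h0 h1.
by apply: ord3_ind; apply: ord3_ind;
  rewrite !sg_vertexE bary_phi (bary_vertex hq) !bary_centerE /=; lra.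
Qed.

Lemma sg_vertex_in_triangle i : in_triangle (sg_vertex q s i).
Proof.
elim/ord3_ind: i; rewrite !sg_vertexE; apply: phi_in_triangle;
  exact: vertex_in_triangle.
Qed.

Lemma gamma_in_triangle x y t : in_triangle x -> in_triangle y -> 0 <= t <= 1 ->
  in_triangle (gamma x y t).
Proof.
move=> tx ty /andP[t0 t1] k; rewrite (affine_gamma _ _ _ (@bary_affine k)).
by rewrite addr_ge0 ?mulr_ge0 ?tx ?ty// subr_ge0.
Qed.

Lemma seg_in_triangle ij t : ij.1 != ij.2 -> 0 <= t <= 1 ->
  in_triangle (gamma (seg_a q s ij) (seg_b q s ij) t).
Proof.
case: ij => i j; elim/ord3_ind: i; elim/ord3_ind: j => //= _ t01;
  rewrite !(seg_aE, seg_bE); apply: gamma_in_triangle => //;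
  apply: phi_in_triangle; exact: vertex_in_triangle.
Qed.

Lemma hull_word (p : 'I_3 -> plane R) f B (w : seq 'I_3) i : affine f ->
  (forall j, f (p j) <= B) ->
  f (word_map (fun j => simil 2^-1 (p j)) w (p i)) <= B.
Proof.
move=> af pB; elim: w => [|j w IH] /=; first exact: pB.
by rewrite af; have := pB j; move: IH; lra.
Qed.

(** At a maximum point of f on the gasket, f is the mean of its value at a vertex
    and of its value at a point of the gasket. *)
Lemma hull_gasket (p : 'I_3 -> plane R) (SG : set (plane R)) f B x :
  is_gasket p SG -> continuous f -> affine f -> (forall j, f (p j) <= B) ->
  SG x -> f x <= B.
Proof.
move=> [SG0 cSG SGE] cf af pB SGx.
have [c /set_mem SGc cmax] := compact_EVT_max SG0 cSG (continuous_subspaceT cf).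
apply: (le_trans (cmax _ (mem_set SGx))).
move: (SGc); rewrite {1}SGE => -[i _ [y SGy yc]].
have := cmax _ (mem_set SGy); have := pB i.
by rewrite -yc af; lra.
Qed.

End cells_and_links.

(** * Approximation by functions constant on cells *)

Section cutoff.
Variables (R : realType) (s : R).
Hypothesis hs : 0 < s < 1 / 3.

(** Equal to 1 on the coordinates of the corner cell, to 0 on those of the rest of
    the hybrid except two segments, and affine in between. *)
Definition cutoff (t : R) : R :=
  Num.max 0 (Num.min 1 ((2 * t - (1 + s)) / (1 - 3 * s))).

Let s3 : 0 < 1 - 3 * s. Proof. by case/andP: hs; lra. Qed.

Lemma cutoff_small t : t <= (1 + s) / 2 -> cutoff t = 0.
Proof.
move=> ts; rewrite /cutoff; apply/max_idPl; rewrite ge_min; apply/orP; right.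
by rewrite mulrC pmulr_rle0 ?invr_gt0//; lra.
Qed.

Lemma cutoff_large t : 1 - s <= t -> cutoff t = 1.
Proof.
move=> ts; rewrite /cutoff (min_idPl _) ?(max_idPr _)//.
by rewrite ler_pdivlMr//; lra.
Qed.

Lemma cutoff_affine t : 0 <= t <= 1 ->
  cutoff ((1 - t) * (1 - s) + t * ((1 + s) / 2)) = 1 - t.
Proof.
move=> /andP[t0 t1]; rewrite /cutoff.
have -> : (2 * ((1 - t) * (1 - s) + t * ((1 + s) / 2)) - (1 + s)) / (1 - 3 * s)
  = 1 - t by field; rewrite gt_eqF.
rewrite (min_idPr _) ?(max_idPr _)//; first by rewrite subr_ge0.
by rewrite gerBl.
Qed.

Lemma cutoff_ge0_le1 t : 0 <= cutoff t <= 1.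
Proof.
rewrite /cutoff le_max lexx /= ge_max ler01 /=.
by rewrite ge_min lexx.
Qed.

Lemma cutoff_continuous : continuous cutoff.
Proof.
pose g t := (2 * t - (1 + s)) / (1 - 3 * s).
have cg : continuous g.
  move=> t; apply: (@cvgM _ _ (nbhs t) _ (fun t => 2 * t - (1 + s))
    (fun=> (1 - 3 * s)^-1)); last exact: cvg_cst.
  apply: (@cvgB _ _ _ (nbhs t) _ (fun t : R => 2 * t) (fun=> 1 + s));
    last exact: cvg_cst.
  by apply: (@cvgM _ _ (nbhs t) _ (fun=> 2) (fun t => t));
    [exact: cvg_cst|exact: cvg_id].
move=> t.
have h1 : {for t, continuous ((fun=> 1) \min g : R -> R^o)}.
  by apply: continuous_min; [exact: cst_continuous|exact: cg].
have h2 : {for t, continuous ((fun=> 0) \max ((fun=> 1) \min g) : R -> R^o)}.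
  by apply: continuous_max; [exact: cst_continuous|exact: h1].
exact: h2.
Qed.

End cutoff.

Lemma within_continuous_bigsetU (T U : topologicalType) (I : eqType)
    (l : seq I) (A : I -> set T) (f : T -> U) :
  (forall i, closed (A i)) -> (forall i, {within A i, continuous f}) ->
  {within \big[setU/set0]_(i <- l) A i, continuous f}.
Proof.
move=> cA cf; elim: l => [|i l IH].
  by rewrite big_nil; exact: continuous_subspace0.
rewrite big_cons; apply: withinU_continuous => //.
by apply: closed_bigsetU => j _.
Qed.

Section approximation.
Variables (R : realType) (q : 'I_3 -> plane R) (s r : R) (SG H : set (plane R)).
Hypothesis hq : unit_equilateral q.
Hypothesis hs : 0 < s < 1 / 3.
Hypothesis hr : 0 < r < 7 / 15.
Hypothesis hSG : is_gasket (sg_vertex q s) SG.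
Hypothesis hH : is_hybrid q s SG H.
Implicit Types (x y : plane R) (u v : plane R -> R).
Notation lam := (bary q).
Notation cells := (cell_sum q s r).
Notation links := (link_form q s).
Notation T := (triangle_form q r).
Notation En := (En q s r).
Notation domE := (domE q s r H).
Notation in_triangle := (in_triangle q).
Notation in_cell := (in_cell q s).
Notation on_link := (on_link q s).

Let s_gt0 : 0 < s. Proof. by case/andP: hs. Qed.
Let s_lt1 : s < 1. Proof. by case/andP: hs => _; lra. Qed.
Let r_gt0 : 0 < r. Proof. by case/andP: hr. Qed.

Definition link_set : set (plane R) :=
  \bigcup_(ij in [set ij : 'I_3 * 'I_3 | ij.1 != ij.2])
     segment (seg_a q s ij) (seg_b q s ij) `|` SG.

Lemma hybridE x : H x <-> (exists i y, H y /\ x = phi q s i y) \/ link_set x.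
Proof.
case: (hH) => _ _ HE; rewrite {1}HE; split.
  by move=> [[i _ [y Hy yx]]|Jx]; [left; exists i, y|right].
by move=> [[i [y [Hy ->]]]|Jx]; [left; exists i => //; exists y|right].
Qed.

Lemma H_cell i x : H x -> H (phi q s i x).
Proof. by move=> Hx; apply/hybridE; left; exists i, x. Qed.

Lemma H_segment ij t : ij.1 != ij.2 -> 0 <= t <= 1 ->
  H (gamma (seg_a q s ij) (seg_b q s ij) t).
Proof.
move=> ij0 t01; apply/hybridE; right; left; exists ij => //.
by exists t => //; rewrite /= in_itv.
Qed.

Lemma compact_H : compact H. Proof. by case: hH. Qed.

Lemma closed_H : closed H.
Proof. by apply: compact_closed; [exact: norm_hausdorff|exact: compact_H]. Qed.

Lemma SG_core x : SG x -> in_core q s x.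
Proof.
move=> SGx k; apply: (hull_gasket hSG _ _ _ SGx).
- exact: bary_continuous.
- exact: bary_affine.
- by move=> j; exact: sg_vertex_in_core.
Qed.

Lemma opp_bary_affine k : affine (fun x => - lam k x).
Proof. by move=> c a x; rewrite bary_affine; ring. Qed.

Lemma SG_in_triangle x : SG x -> in_triangle x.
Proof.
move=> SGx k; rewrite -oppr_le0.
apply: (hull_gasket (f := fun x => - lam k x) hSG _ _ _ SGx).
- move=> y; have cl : lam k z @[z --> y] --> lam k y by exact: bary_continuous.
  exact: (cvgN cl).
- exact: opp_bary_affine.
- by move=> j; rewrite oppr_le0; exact: sg_vertex_in_triangle.
Qed.

Lemma link_set_on_link x : link_set x -> on_link x.
Proof.
move=> [[ij ij0 [t t01 <-]]|/SG_core]; last by left.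
by right; exists ij, t; split => //; move: t01; rewrite /= in_itv.
Qed.

Lemma link_set_in_triangle x : link_set x -> in_triangle x.
Proof.
move=> [[ij ij0 [t t01 <-]]|/SG_in_triangle]//.
by apply: seg_in_triangle => //; move: t01; rewrite /= in_itv.
Qed.

(** At a minimum point of a coordinate on H that lies in a cell, the coordinate is
    at least s times itself, hence nonnegative. *)
Lemma H_in_triangle x : H x -> in_triangle x.
Proof.
case: (hH) => H0 cH _ Hx k.
have cl : continuous (lam k) by exact: bary_continuous.
have [c /set_mem Hc cmin] := compact_EVT_min H0 cH (continuous_subspaceT cl).
apply: le_trans (cmin _ (mem_set Hx)).
move/hybridE : (Hc) => [[i [y [Hy cE]]]|/link_set_in_triangle]//.
have := cmin _ (mem_set Hy); rewrite {1 2}cE bary_phi.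
have := bary_center_ge0 hq k i => b0 h.
have sb : 0 <= (1 - s) * bary_center q k i by rewrite mulr_ge0// subr_ge0 ltW.
have : 0 <= (1 - s) * lam k y by rewrite mulrBl mul1r; lra.
by rewrite pmulr_rge0 ?subr_gt0// => ly; rewrite addr_ge0// mulr_ge0// ltW.
Qed.

Lemma closed_link_set : closed link_set.
Proof.
have hd : hausdorff_space (plane R) by exact: norm_hausdorff.
apply: closedU; last by apply: compact_closed => //; case: hSG.
apply: closed_bigcup; first exact: finite_finset.
move=> ij _; apply: compact_closed => //.
apply: continuous_compact; last exact: segment_compact.
by apply: continuous_subspaceT; exact: continuous_gamma.
Qed.

(** A vertex of the triangle is the limit of the iterates of the similitude that
    fixes it. *)
Lemma vertex_in_H k : H (q k).
Proof.
case: (hH) => -[x0 Hx0] _ _.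
have [i iE] : exists i, center q i = q k.
  by elim/ord3_ind: k; [exists 0|exists 1|exists 2].
pose z n := s ^+ n *: x0 + (1 - s ^+ n) *: q k.
have Hz n : H (z n).
  elim: n => [|n IH]; first by rewrite /z expr0 subrr scale1r scale0r addr0.
  rewrite (_ : z n.+1 = phi q s i (z n)); first exact: H_cell.
  rewrite /z /phi iE /simil scalerDr !scalerA -addrA -scalerDl exprS.
  by congr (_ + _ *: _); ring.
have cs : s ^+ n @[n --> \oo] --> 0 by apply: cvg_expr; rewrite gtr0_norm.
have lim : z n @[n --> \oo] --> 0 *: x0 + (1 - 0) *: q k.
  have cs1 : 1 - s ^+ n @[n --> \oo] --> (1 - 0 : R).
    by apply: cvgB => //; exact: cvg_cst.
  exact: (cvgD (cvgZ cs (cvg_cst x0)) (cvgZ cs1 (cvg_cst (q k)))).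
have -> : q k = 0 *: x0 + (1 - 0) *: q k by rewrite scale0r add0r subr0 scale1r.
exact: (closed_cvg H closed_H (nearW _ Hz) _ lim).
Qed.

(** The cells are disjoint, so at most one index can be picked. *)
Definition glue (F : 'I_6 -> plane R -> R) u x : R :=
  if [pick i | in_cell i x] is Some i then F i (phi_inv q s i x) else u x.

Lemma glue_phi F u i x : in_triangle x -> glue F u (phi q s i x) = F i x.
Proof.
move=> tx; have ix := in_cell_phi hs i tx.
rewrite /glue; case: pickP => [j jx|/(_ i)]; last by rewrite ix.
by rewrite (in_cell_disjoint hq hs jx ix) phiK.
Qed.

Lemma glue_link F u x : (forall i k, F i (q k) = u (phi q s i (q k))) ->
  on_link x -> glue F u x = u x.
Proof.
move=> Fu lx; case: (pickP (fun i => in_cell i x)) => [i ix|no].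
  have [k ->] := link_cell_corner hq hs lx ix.
  by rewrite glue_phi ?Fu//; exact: vertex_in_triangle.
by rewrite /glue; case: pickP => // i; rewrite no.
Qed.

Lemma glue_continuous F u : (forall i k, F i (q k) = u (phi q s i (q k))) ->
  (forall i, {within H, continuous (F i)}) -> {within H, continuous u} ->
  {within H, continuous (glue F u)}.
Proof.
move=> Fu cF cu.
(* H is the finite union of the closed cells and, for None, of the links. *)
pose A (o : option 'I_6) := if o is Some i then phi q s i @` H else link_set.
have AH : H `<=` \big[setU/set0]_(o <- enum {: option 'I_6}) A o.
  move=> x /hybridE hx; rewrite -bigcup_seq.
  case: hx => [[i [y [Hy ->]]]|Jx].
    by exists (Some i); [rewrite /= mem_enum|exists y].
  by exists None => //; rewrite /= mem_enum.
apply: continuous_subspaceW AH _; apply: within_continuous_bigsetU.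
  move=> [i|]; last exact: closed_link_set.
  apply: compact_closed; first exact: norm_hausdorff.
  apply: continuous_compact; last exact: compact_H.
  by apply: continuous_subspaceT; exact: continuous_simil.
move=> [i|] /=; last first.
  apply: (@subspace_eq_continuous _ _ _ u).
    by move=> x /set_mem /link_set_on_link lx; apply/esym; exact: glue_link.
  by apply: continuous_subspaceW cu => x Jx; apply/hybridE; right.
apply: (@subspace_eq_continuous _ _ _ (F i \o phi_inv q s i)).
  move=> _ /set_mem[y Hy <-]; apply/esym; rewrite /from_subspace /=.
  by rewrite (phiK q hs) glue_phi//; exact: H_in_triangle.
apply: continuous_within_comp (cF i); first exact: continuous_simil.
by move=> _ [y Hy <-]; rewrite (phiK q hs).
Qed.

(** Among the functions that have the values of u at the vertices and are constant
    on first-level cells, this one is simple rather than optimal: the three middle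
    cells and the gasket all receive the value u (q 0). *)
Definition crude u x : R :=
  u (q 0) + \sum_(k < 3) (u (q k) - u (q 0)) * cutoff s (lam k x).

Lemma crude_continuous u : continuous (crude u).
Proof.
move=> x; apply: (@cvgD _ _ _ (nbhs x) _ (fun=> u (q 0))); first exact: cvg_cst.
apply: cvg_big => [|k _]; first exact: (@add_continuous R).
apply: (@cvgM _ _ (nbhs x) _ (fun=> u (q k) - u (q 0))); first exact: cvg_cst.
apply: (@cvg_comp _ _ _ (lam k) (cutoff s) _ (nbhs (lam k x))).
  exact: bary_continuous.
exact: cutoff_continuous.
Qed.

Lemma bary_le1 k x : in_triangle x -> lam k x <= 1.
Proof.
move=> tx; have := bary_sum q x; have := tx 0; have := tx 1; have := tx 2.
by elim/ord3_ind: k => *; lra.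
Qed.

Lemma crude_cell u i x y : in_triangle x -> in_triangle y ->
  crude u (phi q s i x) = crude u (phi q s i y).
Proof.
move=> tx ty; congr (_ + _); apply: eq_bigr => k _; congr (_ * _).
have E z : in_triangle z ->
    cutoff s (lam k (phi q s i z)) = (bary_center q k i == 1)%:R.
  move=> tz; rewrite bary_phi; have := tz k; have := bary_le1 k tz.
  move=> z1 z0.
  have sz1 : s * lam k z <= s by rewrite ger_pMr.
  have sz0 : 0 <= s * lam k z by rewrite mulr_ge0// ltW.
  have [b|b|b] : [\/ bary_center q k i = 1, bary_center q k i = 2^-1 |
      bary_center q k i = 0].
    by elim/ord6_ind: i {sz1 sz0}; elim/ord3_ind: k {z1 z0};
      rewrite !(bary_centerE hq);
      do ?[by constructor 1|by constructor 2|by constructor 3].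
  - by rewrite b eqxx cutoff_large//; lra.
  - rewrite b (cutoff_small hs); last first.
      have -> : (1 + s) / 2 = s + (1 - s) * 2^-1 by field.
      by rewrite lerD2r.
    by have /negPf -> : 2^-1 != 1 :> R by rewrite lt_eqF//; lra.
  - rewrite b mulr0 addr0 (cutoff_small hs); last first.
      by apply: (le_trans sz1); move: s_lt1; lra.
    by rewrite eq_sym oner_eq0.
by rewrite !E.
Qed.

Lemma crude_vertex u k : crude u (q k) = u (q k).
Proof.
have E j : cutoff s (lam j (q k)) = (j == k)%:R.
  rewrite (bary_vertex hq); case: (j == k) => /=.
    by rewrite (cutoff_large hs) ?mulr1n// gerBl ltW.
  by rewrite (cutoff_small hs) ?mulr0n// divr_ge0// addr_ge0// ltW.
rewrite /crude (bigD1 k)//= E eqxx mulr1 big1 ?addr0 ?subrKC// => j /negPf jk.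
by rewrite E jk mulr0.
Qed.

Lemma crude_core u x : in_core q s x -> crude u x = u (q 0).
Proof.
move=> cx; rewrite /crude big1 ?addr0// => k _.
rewrite (cutoff_small hs) ?mulr0//; apply: le_trans (cx k) _.
by move: s_gt0; lra.
Qed.

Lemma crude_segment u ij t : ij.1 != ij.2 -> 0 <= t <= 1 ->
  crude u (gamma (seg_a q s ij) (seg_b q s ij) t) =
  u (q ij.1) + t * (u (q 0) - u (q ij.1)).
Proof.
move=> ij0 /[dup] t01 /andP[t0 t1].
have [i_lam j_lam] : lam ij.1 (gamma (seg_a q s ij) (seg_b q s ij) t) =
    (1 - t) * (1 - s) + t * ((1 + s) / 2) /\
    (forall k, k != ij.1 ->
      lam k (gamma (seg_a q s ij) (seg_b q s ij) t) <= (1 + s) / 2).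
  have p : 0 <= (1 - t) * (1 - 3 * s).
    by case/andP: hs => _ s3; rewrite mulr_ge0//; lra.
  have ts : 0 <= t * s by rewrite mulr_ge0// ltW.
  move: s_gt0 hs => s0 /andP[_ s3].
  split=> [|k]; move: ij0; case: ij => i j;
    elim/ord3_ind: i; elim/ord3_ind: j => //= _; do ?elim/ord3_ind: k => //= _;
    rewrite (affine_gamma _ _ _ (@bary_affine _ _ _));
    rewrite !(seg_aE, seg_bE) !bary_phi !(bary_vertex hq) !(bary_centerE hq) /=;
    by [field|lra].
rewrite /crude (bigD1 ij.1)//= i_lam cutoff_affine// big1 => [|k /j_lam kl].
  by ring.
by rewrite (cutoff_small hs) ?mulr0.
Qed.

(** Only the values on the links matter here, and only those in the triangle in
    [En_ext]. This is how glued functions are compared cell by cell. *)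
Lemma link_form_ext m u v :
  (forall x, on_link x -> in_triangle x -> u x = v x) ->
  links m u u = links m v v.
Proof.
move=> uv; rewrite /link_form; congr (_ + _).
  apply: eq_bigr => ij ij0; rewrite !segment_formE; apply: eq_big_nat => l /= lm.
  have pt k : (k <= 2 ^ m)%N ->
      u (gamma (seg_a q s ij) (seg_b q s ij) (dyadic R m k)) =
      v (gamma (seg_a q s ij) (seg_b q s ij) (dyadic R m k)).
    move=> km; have k01 : 0 <= dyadic R m k <= 1.
      rewrite divr_ge0//= ler_pdivrMr ?pow2_gt0// mul1r -natrX ler_nat//.
    by apply: uv; [right; exists ij, (dyadic R m k)|exact: seg_in_triangle].
  by rewrite /slope /= !pt// ltnW.
congr (_ * _); rewrite !gasket_incrE; apply: eq_bigr => w _.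
rewrite !triangle_incr /=.
pose z i := word_map (fun j => simil 2^-1 (sg_vertex q s j)) w (sg_vertex q s i).
have pt i : u (z i) = v (z i).
  apply: uv => [|k].
    left=> k; apply: hull_word; first exact: bary_affine.
    by move=> j; exact: sg_vertex_in_core.
  rewrite -oppr_le0.
  apply: (hull_word (f := fun x => - lam k x)); first exact: opp_bary_affine.
  by move=> j; rewrite oppr_le0; exact: sg_vertex_in_triangle.
by rewrite -!/(z _) !pt.
Qed.

Lemma incr_form_cst es (c : R) : incr_form es (fun=> c : R) (fun=> c) = 0.
Proof. by rewrite /incr_form big1// => e _; rewrite subrr mul0r. Qed.

Lemma link_form_cst m (c : R) : links m (fun=> c) (fun=> c) = 0.
Proof.
rewrite /link_form /gasket_form incr_form_cst mulr0 addr0 big1// => ij _.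
by rewrite /segment_form incr_form_cst mulr0.
Qed.

Lemma En_ext m u v : (forall x, in_triangle x -> u x = v x) ->
  En m u u = En m v v.
Proof.
elim: m u v => [|m IH] u v uv.
  by rewrite !En0 !triangle_formE !uv//; exact: vertex_in_triangle.
rewrite !EnS; congr (_ + _); last by apply: link_form_ext => x _; exact: uv.
congr (_ * _); apply: eq_bigr => i _; apply: IH => x tx.
by rewrite /= uv//; exact: phi_in_triangle.
Qed.

Lemma En_cst m (c : R) : En m (fun=> c) (fun=> c) = 0.
Proof.
elim: m => [|m IH].
  by rewrite En0 /triangle_form incr_form_cst mulr0.
by rewrite EnS link_form_cst addr0 /cell_sum big1 ?mulr0.
Qed.

(** Only the four segments that start at the corners 1 and 2 contribute. *)
Lemma crude_energy m u :
  En m.+1 (crude u) (crude u) <= 2 * Rconst r * T u u.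
Proof.
rewrite EnS /cell_sum big1 ?mulr0 ?add0r => [|i _]; last first.
  rewrite (@En_ext m _ (fun=> crude u (phi q s i (q 0)))) ?En_cst// => x tx /=.
  by apply: crude_cell => //; exact: vertex_in_triangle.
have seg ij : ij.1 != ij.2 -> segment_form q s m ij (crude u) (crude u) =
    (u (q 0) - u (q ij.1)) ^+ 2.
  move=> ij0; rewrite segment_formE /dyadic_form.
  rewrite (eq_big_nat _ _ (F2 := fun=> (u (q 0) - u (q ij.1)) ^+ 2 / 2 ^+ m)).
    by rewrite sumr_const_nat subn0 -[LHS]mulr_natr natrX divfK.
  move=> l /= lm.
  have pt k : (k <= 2 ^ m)%N -> 0 <= dyadic R m k <= 1.
    by move=> km; rewrite divr_ge0//= ler_pdivrMr ?pow2_gt0// mul1r -natrX ler_nat.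
  rewrite /slope /= !crude_segment ?pt//; last exact: ltnW.
  rewrite /dyadic -natr1; field.
  by rewrite expf_neq0.
rewrite /link_form.
have -> : gasket_form q s m (crude u) (crude u) = 0.
  rewrite /gasket_form gasket_incrE big1 ?mulr0// => w _.
  rewrite triangle_incr /= !crude_core ?/tri ?subrr ?expr0n ?addr0//;
    move=> k; apply: hull_word; do ?exact: bary_affine;
    by move=> j; exact: sg_vertex_in_core.
rewrite addr0 (eq_bigr _ seg) sum_ordered_pairs /=.
rewrite triangle_formE mulrA mulfK ?gt_eqF ?Rconst_gt0// /tri subrr.
have := sqr_ge0 (u (q 1) - u (q 2)); rewrite expr0n /=.
by move: (u (q 0)) (u (q 1)) (u (q 2)) => a b c; lra.
Qed.

Fixpoint approx (n : nat) u : plane R -> R :=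
  if n is n'.+1 then glue (fun i => approx n' (u \o phi q s i)) u
  else crude u.

Lemma approx_vertex n u k : approx n u (q k) = u (q k).
Proof.
elim: n u k => [|n IH] u k /=; first exact: crude_vertex.
have [i iE] : exists i, phi q s i (q k) = q k.
  by elim/ord3_ind: k; [exists 0|exists 1|exists 2]; rewrite !phi_vertex.
rewrite -{1}iE glue_phi; last exact: vertex_in_triangle.
by rewrite IH /= iE.
Qed.

Lemma approx_corner n u i k :
  approx n (u \o phi q s i) (q k) = u (phi q s i (q k)).
Proof. by rewrite approx_vertex. Qed.

Lemma continuous_cell u i : {within H, continuous u} ->
  {within H, continuous (u \o phi q s i)}.
Proof.
move=> cu; apply: continuous_within_comp cu; first exact: continuous_simil.
by move=> x; exact: H_cell.
Qed.

Lemma approx_continuous n u : {within H, continuous u} ->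
  {within H, continuous (approx n u)}.
Proof.
elim: n u => [|n IH] u cu /=.
  by apply: continuous_subspaceT; exact: crude_continuous.
apply: glue_continuous => // [i k|i]; first exact: approx_corner.
by apply: IH; exact: continuous_cell.
Qed.

Lemma word_in_triangle (w : seq 'I_6) x :
  in_triangle x -> in_triangle (word_map (phi q s) w x).
Proof.
by move=> tx; elim: w => // i w IH; exact: phi_in_triangle.
Qed.

Lemma approx_cell n u (w : seq 'I_6) x y : size w = n.+1 ->
  in_triangle x -> in_triangle y ->
  approx n u (word_map (phi q s) w x) = approx n u (word_map (phi q s) w y).
Proof.
elim: n u w => [|n IH] u [|i w]//= [sw] tx ty.
  by case: w sw => //= _; exact: crude_cell.
by rewrite !glue_phi; [exact: IH|exact: word_in_triangle|exact: word_in_triangle].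
Qed.

(** The difference vanishes on the links of level less than n, and inside each
    n-cell it is a function minus its crude replacement. *)
Lemma approx_energy n m u :
  En (n + m.+1) (u \- approx n u) (u \- approx n u) <=
  2 * iter n cells (En m.+1) u u + 4 * Rconst r * iter n cells T u u.
Proof.
elim: n u => [|n IH] u.
  have [_ h] := polar_le2 u (crude u) (En_polar q s r m.+1) (En_ge0 q s hr m.+1).
  apply: le_trans h _; rewrite lerD2l.
  have -> : 4 * Rconst r * T u u = 2 * (2 * Rconst r * T u u) by ring.
  by rewrite ler_pM2l// crude_energy.
rewrite addSn EnS.
have -> : links (n + m.+1) (u \- approx n.+1 u) (u \- approx n.+1 u) = 0.
  rewrite (@link_form_ext _ _ (fun=> 0)) ?link_form_cst// => x lx _ /=.
  rewrite glue_link ?subrr// => i k; exact: approx_corner.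
rewrite addr0 !iterS -cell_sumZ -[X in _ + X]cell_sumZ -cell_sumD.
rewrite /cell_sum ler_pM2l ?invr_gt0//; apply: ler_sum => i _.
apply: le_trans (IH (u \o phi q s i)); rewrite le_eqVlt; apply/orP; left; apply/eqP.
by apply: En_ext => x tx /=; rewrite glue_phi.
Qed.

(** The energy of u inside the n-cells is at most what remains of the total after
    the links outside them. *)
Lemma En_split n m u :
  iter n cells (En m) u u + links_up_to q s r n u u <= En (n + m) u u.
Proof.
elim: n u => [|n IH] u; first by rewrite /links_up_to big_geq// addr0.
rewrite addSn EnS /links_up_to big_nat_recl//= subn0 addrCA [leLHS]addrC lerD//.
  under eq_big_nat => k _ do rewrite -[X in (_ - X)%N]add1n subnDA subn1.
  rewrite -cell_sum_sum -cell_sumD.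
  by apply: (cell_sum_le q s hr
    (F := fun u v => iter n cells (En m) u v + links_up_to q s r n u v)).
by apply: link_form_nd; exact: leq_addr.
Qed.

(** The factor 7 is not sharp. On an n-cell the approximation is the value at one
    corner plus two increments between corners, each weighted by a cutoff in
    [0, 1]. *)
Lemma approx_near n u x : H x ->
  approx n u x = u x \/
  exists w y, [/\ size w = n, H y, x = word_map (phi q s) w y &
    forall e, (forall k, `|u (word_map (phi q s) w (q k)) - u x| <= e) ->
      `|approx n u x - u x| <= 7 * e].
Proof.
elim: n u x => [|n IH] u x Hx.
  right; exists [::], x; split => //= e ue.
  have e0 : 0 <= e by apply: le_trans (ue 0).
  rewrite /crude sum_ord3 subrr mul0r add0r.
  have b k : `|(u (q k) - u (q 0)) * cutoff s (lam k x)| <= 2 * e.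
    rewrite normrM; have /andP[c0 c1] := cutoff_ge0_le1 s (lam k x).
    rewrite (ger0_norm c0); apply: (@le_trans _ _ (`|u (q k) - u (q 0)|)).
      by rewrite ler_piMr.
    have -> : u (q k) - u (q 0) = (u (q k) - u x) - (u (q 0) - u x) by ring.
    by apply: le_trans (ler_normB _ _) _; have := ue k; have := ue 0; lra.
  set A := (u (q 1) - _) * _ in b *; set B := (u (q 2) - _) * _.
  have -> : u (q 0) + (A + B) - u x = (u (q 0) - u x) + (A + B) by ring.
  apply: le_trans (ler_normD _ _) _; have := ler_normD A B.
  have := b 1; have := b 2; have := ue 0; rewrite -/A -/B; lra.
move/hybridE : Hx => [[i [y [Hy ->]]]|/link_set_on_link lx]; last first.
  by left; rewrite /= glue_link// => i k; exact: approx_corner.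
rewrite /= glue_phi; last exact: H_in_triangle.
have [->|[w [z [sw Hz yE near]]]] := IH (u \o phi q s i) y Hy; first by left.
right; exists (i :: w), z; split => //=; first by rewrite sw.
by rewrite -yE.
Qed.

Lemma phi_dist i x y : `|phi q s i x - phi q s i y| = s * `|x - y|.
Proof.
rewrite /phi /simil opprD addrACA subrr addr0 -scalerBr.
by rewrite normrZ gtr0_norm.
Qed.

Lemma word_dist (w : seq 'I_6) x y :
  `|word_map (phi q s) w x - word_map (phi q s) w y| = s ^+ size w * `|x - y|.
Proof.
elim: w => [|i w IH] /=; first by rewrite expr0 mul1r.
by rewrite phi_dist IH exprS mulrA.
Qed.

Lemma word_in_H (w : seq 'I_6) x : H x -> H (word_map (phi q s) w x).
Proof. by move=> Hx; elim: w => //= i w IH; exact: H_cell. Qed.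

(** All points of the n-cell of x are within a multiple of s^n of x. *)
Lemma approx_cvg u x : {within H, continuous u} -> H x ->
  approx n u x @[n --> \oo] --> u x.
Proof.
move=> cu Hx; apply/cvgrPdist_le => e e0.
have [M [_ HM]] := compact_bounded compact_H.
have {}HM y : H y -> `|y| <= M + 1.
  by move=> Hy; apply: (HM (M + 1)) => //; rewrite ltrDl.
have M0 : 0 <= M + 1 by apply: le_trans (HM _ Hx).
have /subspace_continuousP /(_ x Hx) := cu.
have e7 : 0 < e / 7 by rewrite divr_gt0.
move=> /cvgrPdist_le /(_ _ e7) near_x.
have /nbhs_ballP[d /= d0 dP] :
  nbhs x (fun y => H y -> `|u x - u y| <= e / 7) := near_x.
have sn : s ^+ n * (2 * (M + 1)) @[n --> \oo] --> 0.
  rewrite -[X in _ --> X](mul0r (2 * (M + 1))); apply: cvgM; last exact: cvg_cst.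
  by apply: cvg_expr; rewrite gtr0_norm.
move/cvgrPdist_lt : sn => /(_ _ d0)[N _ NP]; exists N => // n /= Nn.
have := NP n Nn; rewrite /= sub0r normrN => sd.
have [->|[w [y [sw Hy xE]]]] := approx_near n u Hx.
  by rewrite subrr normr0 ltW.
rewrite distrC => close; have -> : e = 7 * (e / 7) by field.
apply: close => k; rewrite distrC; apply: dP; last exact/word_in_H/vertex_in_H.
rewrite -ball_normE /= {1}xE word_dist sw.
apply: le_lt_trans sd; apply: (le_trans _ (ler_norm _)).
rewrite ler_wpM2l ?exprn_ge0 ?(ltW s_gt0)//.
apply: le_trans (ler_normB _ _) _.
by have := HM _ Hy; have := HM _ (vertex_in_H k); lra.
Qed.

Lemma approx_domE u n : domE u ->
  domE (u \- approx n u) /\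
  E q s r (u \- approx n u) (u \- approx n u) <=
    2 * (E q s r u u - links_up_to q s r n u u)
    + 4 * Rconst r * iter n cells T u u.
Proof.
move=> du; set B := (X in _ <= X).
have dB m : En m (u \- approx n u) (u \- approx n u) <= B.
  apply: (@le_trans _ _ (En (n + m.+1) (u \- approx n u) (u \- approx n u))).
    by apply: (En_nd q s hr); rewrite addnS ltnW// ltnS leq_addl.
  apply: le_trans (approx_energy n m u) _; rewrite lerD2r ler_pM2l//.
  rewrite lerBrDr; apply: le_trans (En_split n m.+1 u) _.
  exact: (En_le_E hr _ du).
have dd : domE (u \- approx n u).
  apply: (domE_bounded hr _ dB) => x; apply: cvgB; first exact: du.1.
  by apply: approx_continuous; exact: du.1.
by split => //; exact: (E_le dd dB).
Qed.

Lemma domE_domEtilde u : domE u -> domEtilde q s r H u.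
Proof.
move=> du; split => //; exists (fun n => approx n u); split.
- move=> n; exists n.+1 => //; split.
    have [dd _] := approx_domE n du.
    have -> : approx n u = u \- (u \- approx n u).
      by apply/funext => x /=; rewrite subKr.
    exact: (domE_B hr du dd).
  move=> a _ _ [x Hx <-] [y Hy <-]; apply: approx_cell.
  + by rewrite size_tuple.
  + exact: H_in_triangle.
  + exact: H_in_triangle.
- have [cT cS] := cell_energy_vanishes hr du.
  have cB : 2 * (E q s r u u - links_up_to q s r n u u)
      + 4 * Rconst r * iter n cells T u u @[n --> \oo] --> 0.
    rewrite [X in _ --> X](_ : 0 = 2 * (E q s r u u - E q s r u u)
      + 4 * Rconst r * 0); last by rewrite subrr !mulr0 addr0.
    apply: cvgD; apply: cvgM; try exact: cvg_cst; last exact: cT.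
    by apply: cvgB; [exact: cvg_cst|exact: cS].
  apply: (squeeze_cvgr _ (cvg_cst 0) cB); apply: nearW => n.
  have [dd ->] := approx_domE n du; rewrite andbT.
  by apply: le_trans (En_le_E hr 0 dd); exact: En_ge0.
- by move=> x Hx; apply: approx_cvg => //; exact: du.1.
Qed.

End approximation.

(** * Coincidence of the two forms *)

Theorem theorem2p4 (R : realType) (q : 'I_3 -> plane R) (s r : R)
    (SG H : set (plane R))
    (hq : unit_equilateral q)
    (hs : 0 < s < 1 / 3)
    (hr : 0 < r < 7 / 15)
    (hSG : is_gasket (sg_vertex q s) SG)
    (hH : is_hybrid q s SG H) :
  coincide (formE q s r H) (formEtilde q s r H).
Proof.
split=> /=.
  apply/seteqP; split=> u; last by case.
  exact: (domE_domEtilde hq hs hr hSG hH).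
move=> u v du dv.
exact: (E_Etilde hr (H_cell hH) (H_segment hH) du dv).
Qed.
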